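(* The index set $\{e : e \text{ is an index of a computable structure that is } \mathbf{0}'\text{-computably bi-embeddably categorical}\}$ is $\Pi^1_1$-complete.
   Context: Computable structures are indexed by natural numbers $e$ via a standard enumeration of (atomic diagrams of) computable structures. Two structures are bi-embeddable ($\approx$) if each embeds isomorphically into the other. A computable structure $\mathcal{S}$ is $\mathbf{d}$-computably bi-embeddably categorical if for every computable $\mathcal{A}\approx\mathcal{S}$ there are $\mathbf{d}$-computable embeddings $\mathcal{A}\hookrightarrow\mathcal{S}$ and $\mathcal{S}\hookrightarrow\mathcal{A}$; here $\mathbf{0}'$ is the degree of the halting problem. *)

(* Defs.v *)
From mathcomp Require Import all_boot.
From Stdlib Require Import ClassicalEpsilon.
Set Implicit Arguments. Unset Strict Implicit. Unset Printing Implicit Defensive.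

(* Pairing on nat: <a,b> = 2^a (2b+1) - 1, a bijection nat*nat -> nat. *)
Definition npair (a b : nat) : nat := (2 ^ a * b.*2.+1).-1.
Definition nfst (x : nat) : nat := logn 2 x.+1.
Definition nsnd (x : nat) : nat := (x.+1 %/ 2 ^ logn 2 x.+1).-1./2.

(* Oracle partial recursive functions (unary, with built-in pairing).  *)
Inductive code : Type :=
  | CZero
  | CSucc
  | CId
  | CFst
  | CSnd
  | COracle
  | CPair of code & code
  | CComp of code & code
  | CRec of code & code    (* h<0,y> = f y, h<n+1,y> = g<<n,y>, h<n,y>> *)
  | CMu of code.           (* x |-> least n with f<n,x> = 0 (all earlier defined) *)

Fixpoint eval (A : nat -> bool) (fuel : nat) (c : code) (x : nat) {struct fuel}
  : option nat :=
  match fuel with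
  | 0 => None
  | k.+1 =>
    match c with
    | CZero => Some 0
    | CSucc => Some x.+1
    | CId => Some x
    | CFst => Some (nfst x)
    | CSnd => Some (nsnd x)
    | COracle => Some (nat_of_bool (A x))
    | CPair f g =>
        match eval A k f x, eval A k g x with
        | Some a, Some b => Some (npair a b)
        | _, _ => None
        end
    | CComp f g =>
        match eval A k g x with
        | Some y => eval A k f y
        | None => None
        end
    | CRec f g =>
        let y := nsnd x in
        (fix loop (n : nat) : option nat :=
           match n with
           | 0 => eval A k f y
           | m.+1 => match loop m with
                     | Some v => eval A k g (npair (npair m y) v)
                     | None => None
                     end
           end) (nfst x)
    | CMu f =>
        (fix search (i bound : nat) : option nat :=
           match bound with
           | 0 => None
           | b.+1 => match eval A k f (npair i x) with
                     | Some 0 => Some i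
                     | Some _ => search i.+1 b
                     | None => None
                     end
           end) 0 k
    end
  end.

(* Goedel numbering: index e denotes the code obtained by decoding the
   (canonical countable) tree unpickle e; undecodable indices denote the
   nowhere-defined function. *)
Fixpoint code_of_tree (t : GenTree.tree nat) : option code :=
  match t with
  | GenTree.Leaf 0 => Some CZero
  | GenTree.Leaf 1 => Some CSucc
  | GenTree.Leaf 2 => Some CId
  | GenTree.Leaf 3 => Some CFst
  | GenTree.Leaf 4 => Some COracle
  | GenTree.Leaf 5 => Some CSnd
  | GenTree.Node n [:: t1; t2] =>
      match code_of_tree t1, code_of_tree t2 with
      | Some f, Some g =>
          match n with
          | 0 => Some (CPair f g)
          | 1 => Some (CComp f g)
          | 2 => Some (CRec f g)
          | _ => None
          end
      | _, _ => None
      end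
  | GenTree.Node 3 [:: t1] =>
      match code_of_tree t1 with Some f => Some (CMu f) | None => None end
  | _ => None
  end.

Definition decode (e : nat) : option code :=
  match unpickle e : option (GenTree.tree nat) with
  | Some t => code_of_tree t
  | None => None
  end.

Definition phi (A : nat -> bool) (e x y : nat) : Prop :=
  exists fuel c, decode e = Some c /\ eval A fuel c x = Some y.

Definition empty_oracle : nat -> bool := fun _ => false.
Definition phi0 (e x y : nat) : Prop := phi empty_oracle e x y.

Definition halting (e : nat) : Prop := exists y, phi0 e e y.
Definition halting_oracle : nat -> bool :=
  fun e => if excluded_middle_informative (halting e) then true else false.

Definition computable_fun (f : nat -> nat) : Prop :=
  exists e, forall x, phi0 e x (f x).
Definition computable_in (A : nat -> bool) (f : nat -> nat) : Prop :=
  exists e, forall x, phi A e x (f x).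
Definition zero_jump_computable (f : nat -> nat) : Prop :=
  computable_in halting_oracle f.

(* Structures: domain nat, universal relational language with symbols
   (i, n) for every i and every arity n; R i s means R_{i,|s|}(s).      *)
Definition structure := nat -> seq nat -> Prop.

Definition embedding (f : nat -> nat) (A B : structure) : Prop :=
  injective f /\ forall i (s : seq nat), A i s <-> B i (map f s).

Definition embeds (A B : structure) : Prop := exists f, embedding f A B.
Definition biemb (A B : structure) : Prop := embeds A B /\ embeds B A.

(* The standard enumeration of computable structures: e is an index of a
   computable structure iff phi_e is a total {0,1}-valued function,
   read as the characteristic function of the atomic diagram. *)
Definition is_struct_index (e : nat) : Prop :=
  forall x, exists b, b <= 1 /\ phi0 e x b.

Definition struct_of (e : nat) : structure :=
  fun i s => phi0 e (pickle (i, s)) 1.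

Definition zero_jump_cbe_categorical (e : nat) : Prop :=
  forall a, is_struct_index a -> biemb (struct_of a) (struct_of e) ->
    exists f g, zero_jump_computable f /\ zero_jump_computable g /\
      embedding f (struct_of a) (struct_of e) /\
      embedding g (struct_of e) (struct_of a).

Definition index_set_0jump_cbe (e : nat) : Prop :=
  is_struct_index e /\ zero_jump_cbe_categorical e.

(* Pi^1_1 sets (Kleene normal form) and Pi^1_1-completeness under
   computable many-one reductions. *)
Definition Pi11 (X : nat -> Prop) : Prop :=
  exists r : nat -> nat, computable_fun r /\
    forall n, X n <->
      forall g : nat -> nat, exists m, r (pickle (n, [seq g i | i <- iota 0 m])) = 0.

Definition m_reducible (Y X : nat -> Prop) : Prop :=
  exists h, computable_fun h /\ forall n, Y n <-> X (h n).

Definition Pi11_complete (X : nat -> Prop) : Prop :=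
  Pi11 X /\ forall Y, Pi11 Y -> m_reducible Y X.

(* Main.v *)
(** A reduction tree [T_n] is attached to a Pi^1_1 set [Y]: [n] is in [Y] iff
    [T_n] has no infinite path.  Pairing the paths with a Pi^0_1 class that is
    nonempty but has no 0'-computable member, one may assume that no path is
    0'-computable.  The structure [S_n] has, for every node [s] of [T_n], a finite
    equivalence class whose elements are labelled by the initial segments of [s];
    the class of [s] embeds in the class of [t] iff [s] is an initial segment of
    [t].  A self-embedding of [S_n] is therefore an injection of [T_n] into itself
    that extends every node, and iterating it at a node it moves produces a path.
    - If there is no path, every self-embedding is the identity, so a structure
      bi-embeddable with [S_n] is isomorphic to it, and [0'] finds the isomorphism
      by looking for the longest label in a class.
    - If there is a path, [S_n] is bi-embeddable with [S_n] minus the class of the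
      root (shift along the path), but an embedding of [S_n] into that substructure
      moves the root and so computes a path; hence it is not 0'-computable.

    For the Pi^1_1 upper bound no universal machine is needed: the function
    quantifier ranges over tables of all values of [eval], which are pinned down by
    the local recursion equations of [eval].  The same tables form the Pi^0_1 class
    used above, since they compute a function that diagonalises against every
    0'-computable function. *)
Require Import Defs.
From mathcomp Require Import all_boot zify.
From Stdlib Require Import ClassicalEpsilon FunctionalExtensionality.
Set Implicit Arguments. Unset Strict Implicit. Unset Printing Implicit Defensive.

(** * Pairing and evaluation of codes *)

Arguments npair : simpl never.
Arguments nfst : simpl never.
Arguments nsnd : simpl never.

Lemma npairS a b : (npair a b).+1 = 2 ^ a * b.*2.+1.
Proof. by rewrite prednK // muln_gt0 expn_gt0. Qed.

Lemma logn_npair a b : logn 2 (2 ^ a * b.*2.+1) = a.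
Proof.
rewrite lognM ?expn_gt0 // lognX logn_prime // eqxx muln1 lognE /= dvdn2 /=.
by rewrite odd_double addn0.
Qed.

Lemma nfst_npair a b : nfst (npair a b) = a.
Proof. by rewrite /nfst npairS logn_npair. Qed.

Lemma nsnd_npair a b : nsnd (npair a b) = b.
Proof.
by rewrite /nsnd npairS logn_npair mulKn ?expn_gt0 //= half_double.
Qed.

Lemma npair_nfst_nsnd x : npair (nfst x) (nsnd x) = x.
Proof.
apply: succn_inj; rewrite npairS /nsnd /nfst.
have dvd : 2 ^ logn 2 x.+1 %| x.+1 by apply: pfactor_dvdnn.
have /dvdnP[q def] := dvd.
have q_odd : odd q.
  apply/negPn/negP => /negPf q_even.
  have: 2 ^ (logn 2 x.+1).+1 %| x.+1.
    by rewrite {2}def expnS dvdn_pmul2r ?expn_gt0 // dvdn2 q_even.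
  by rewrite pfactor_dvdn // ltnn.
rewrite {2}def mulnK ?expn_gt0 // [RHS]def mulnC; congr (_ * _).
by move: q_odd; clear; lia.
Qed.

Lemma npair_inj a b a' b' : npair a b = npair a' b' -> a = a' /\ b = b'.
Proof.
by move=> e; move: (congr1 nfst e) (congr1 nsnd e); rewrite !nfst_npair !nsnd_npair.
Qed.

Lemma leq_npair a b : b <= npair a b.
Proof.
rewrite -ltnS npairS; apply: (@leq_trans b.*2.+1); first by rewrite ltnS -addnn leq_addr.
by rewrite leq_pmull // expn_gt0.
Qed.

(** The inner [fix] of [eval] for [CRec], and after it the one for [CMu], get names so that
    inductions on them can be stated. *)
Definition rec_loop (f g : nat -> option nat) (y : nat) := fix loop (n : nat) : option nat :=
  match n with
  | 0 => f y
  | m.+1 => match loop m with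
            | Some v => g (npair (npair m y) v)
            | None => None
            end
  end.

Definition mu_loop (f : nat -> option nat) (x : nat) := fix search (i bound : nat) : option nat :=
  match bound with
  | 0 => None
  | b.+1 => match f (npair i x) with
            | Some 0 => Some i
            | Some _ => search i.+1 b
            | None => None
            end
  end.

Lemma evalS A k c x : eval A k.+1 c x =
  match c with
  | CZero => Some 0
  | CSucc => Some x.+1
  | CId => Some x
  | CFst => Some (nfst x)
  | CSnd => Some (nsnd x)
  | COracle => Some (nat_of_bool (A x))
  | CPair f g =>
      match eval A k f x, eval A k g x with
      | Some a, Some b => Some (npair a b)
      | _, _ => None
      end
  | CComp f g => obind (eval A k f) (eval A k g x)
  | CRec f g => rec_loop (eval A k f) (eval A k g) (nsnd x) (nfst x)
  | CMu f => mu_loop (eval A k f) x 0 k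
  end.
Proof. by case: c. Qed.

Lemma eval_step A k c x y : eval A k c x = Some y -> eval A k.+1 c x = Some y.
Proof.
elim: k c x y => // k IH c x y; rewrite (evalS _ k) (evalS _ k.+1); case: c => //.
- move=> f g.
  case Ef: (eval A k f x) => [a|] //; case Eg: (eval A k g x) => [b|] //.
  by rewrite (IH _ _ _ Ef) (IH _ _ _ Eg).
- move=> f g; rewrite /obind /oapp.
  by case Eg: (eval A k g x) => [b|] // /IH Ef; rewrite (IH _ _ _ Eg).
- move=> f g; elim: (nfst x) y => [|n IHn] y; first exact: IH.
  rewrite /=; case El: (rec_loop _ _ _ n) => [v|] // Eg.
  by rewrite (IHn _ El); apply: IH.
- move=> f.
  (* The fuel is also the bound of the search, so both grow by one. *)
  suff H b i : mu_loop (eval A k f) x i b = Some y ->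
               mu_loop (eval A k.+1 f) x i b.+1 = Some y by apply: H.
  elim: b i => // b IHb i; rewrite [mu_loop _ _ _ b.+1]/=.
  rewrite [mu_loop _ _ _ b.+2]/(mu_loop _ _ _ _.+1) /mu_loop -/(mu_loop _ _).
  case E: (eval A k f (npair i x)) => [[|v]|] //; rewrite (IH _ _ _ E) //.
  exact: IHb.
Qed.

Lemma eval_mono A k k' c x y :
  k <= k' -> eval A k c x = Some y -> eval A k' c x = Some y.
Proof.
move/subnK <-; elim: (k' - k) => // d IH /IH; exact: eval_step.
Qed.

Definition ev A c x y := exists k, eval A k c x = Some y.

Lemma ev_inj A c x y y' : ev A c x y -> ev A c x y' -> y = y'.
Proof.
case=> k Ek [k' Ek']; have := eval_mono (leq_maxl k k') Ek.
by rewrite (eval_mono (leq_maxr k k') Ek') => -[].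
Qed.

Lemma ev_pair A f g x a b : ev A f x a -> ev A g x b -> ev A (CPair f g) x (npair a b).
Proof.
case=> k Ek [k' Ek']; exists (maxn k k').+1; rewrite evalS.
by rewrite (eval_mono (leq_maxl k k') Ek) (eval_mono (leq_maxr k k') Ek').
Qed.

Lemma ev_comp A f g x y z : ev A g x y -> ev A f y z -> ev A (CComp f g) x z.
Proof.
case=> k Ek [k' Ek']; exists (maxn k k').+1; rewrite evalS.
by rewrite (eval_mono (leq_maxl k k') Ek) /= (eval_mono (leq_maxr k k') Ek').
Qed.

Lemma ev_rec A f g y n (h : nat -> nat) :
  ev A f y (h 0) -> (forall m, m < n -> ev A g (npair (npair m y) (h m)) (h m.+1)) ->
  ev A (CRec f g) (npair n y) (h n).
Proof.
move=> f0 gS.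
have [k Ef Eg] : exists2 k, eval A k f y = Some (h 0) &
    forall m, m < n -> eval A k g (npair (npair m y) (h m)) = Some (h m.+1).
  elim: n gS => [|n IH] gS; first by case: f0 => k Ek; exists k.
  case: IH => [m mn|k Ef Eg]; first by apply: gS; rewrite ltnW.
  case: (gS n (ltnSn n)) => k' Ek'; exists (maxn k k').
    exact: eval_mono (leq_maxl _ _) Ef.
  move=> m; rewrite ltnS leq_eqVlt => /orP[/eqP->|/Eg].
    exact: eval_mono (leq_maxr _ _) Ek'.
  exact: eval_mono (leq_maxl _ _).
exists k.+1; rewrite evalS nfst_npair nsnd_npair.
elim: n {gS} Eg => [|n IH] Eg //.
by rewrite /= IH ?Eg // => m mn; apply: Eg; rewrite ltnW.
Qed.

Lemma ev_mu A f x n :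
  (forall i, i < n -> exists v, ev A f (npair i x) v.+1) -> ev A f (npair n x) 0 ->
  ev A (CMu f) x n.
Proof.
move=> fS f0.
have [k [Ef nk Eg]] : exists k, [/\ eval A k f (npair n x) = Some 0, n < k &
    forall i, i < n -> exists v, eval A k f (npair i x) = Some v.+1].
  have [k Eg] : exists k, forall i, i < n -> exists v, eval A k f (npair i x) = Some v.+1.
    elim: {f0} n fS => [|n IH] gS; first by exists 0.
    case: IH => [m mn|k Eg]; first by apply: gS; rewrite ltnW.
    case: (gS n (ltnSn n)) => v [k' Ek']; exists (maxn k k').
    move=> m; rewrite ltnS leq_eqVlt => /orP[/eqP->|/Eg[w Ew]].
      by exists v; apply: eval_mono (leq_maxr _ _) Ek'.
    by exists w; apply: eval_mono (leq_maxl _ _) Ew.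
  (* Since the fuel bounds the search as well, it must exceed [n]. *)
  case: f0 => k' Ek'; exists (maxn (maxn k k') n.+1); split.
  - by apply: eval_mono Ek'; rewrite -maxnA maxnCA leq_maxl.
  - exact: leq_maxr.
  - move=> i /Eg[v Ev]; exists v; apply: eval_mono Ev.
    by rewrite -maxnA leq_maxl.
exists k.+1; rewrite evalS.
suff H b i : n = i + b -> forall b', b < b' -> mu_loop (eval A k f) x i b' = Some n.
  exact: (H n 0).
elim: b i => [|b IH] i; first by rewrite addn0 => <- [] // b' _ /=; rewrite Ef.
move=> def [] // b' bb' /=; case: (Eg i) => [|v ->]; first by rewrite def -addSnnS leq_addr.
by apply: IH; rewrite ?addSnnS.
Qed.

(** * Closure properties of relative computability *)

Definition orec A (f : nat -> nat) := exists c, forall x, ev A c x (f x).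
Definition orec2 A (f : nat -> nat -> nat) := orec A (fun z => f (nfst z) (nsnd z)).
Definition orec3 A (f : nat -> nat -> nat -> nat) :=
  orec A (fun z => f (nfst z) (nfst (nsnd z)) (nsnd (nsnd z))).

Section Closure.
Variable A : nat -> bool.

Lemma orec_ext f g : f =1 g -> orec A f -> orec A g.
Proof. by move=> e [c Ec]; exists c => x; rewrite -e. Qed.

Lemma orec_id : orec A (fun x => x).
Proof. by exists CId => x; exists 1. Qed.

Lemma orec_app1 f a : orec A f -> orec A a -> orec A (fun x => f (a x)).
Proof. by case=> c Ec [d Ed]; exists (CComp c d) => x; apply: ev_comp. Qed.

Lemma orec_pair a b : orec A a -> orec A b -> orec A (fun x => npair (a x) (b x)).
Proof. by case=> c Ec [d Ed]; exists (CPair c d) => x; apply: ev_pair. Qed.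

Lemma orec_app2 f a b : orec2 A f -> orec A a -> orec A b -> orec A (fun x => f (a x) (b x)).
Proof.
move=> Cf Ca Cb; apply: orec_ext (orec_app1 Cf (orec_pair Ca Cb)) => x.
by rewrite nfst_npair nsnd_npair.
Qed.

Lemma orec_app3 f a b c : orec3 A f -> orec A a -> orec A b -> orec A c ->
  orec A (fun x => f (a x) (b x) (c x)).
Proof.
move=> Cf Ca Cb Cc; apply: orec_ext (orec_app1 Cf (orec_pair Ca (orec_pair Cb Cc))) => x.
by rewrite !nfst_npair !nsnd_npair nfst_npair.
Qed.

Lemma orec_succ : orec A S.
Proof. by exists CSucc => x; exists 1. Qed.

Lemma orec_const n : orec A (fun=> n).
Proof.
elim: n => [|n IH]; first by exists CZero => x; exists 1.
exact: orec_app1 orec_succ IH.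
Qed.

Lemma orec_fst : orec A nfst.
Proof. by exists CFst => x; exists 1. Qed.

Lemma orec_snd : orec A nsnd.
Proof. by exists CSnd => x; exists 1. Qed.

Lemma orec_oracle : orec A (fun x => A x).
Proof. by exists COracle => x; exists 1. Qed.

(** The step [s] is tested on arguments [npair (npair k x) v], the shape in which [CRec] feeds its
    second code. *)
Lemma orec_iteri n z s : orec A n -> orec A z ->
  orec A (fun w => s (nfst (nfst w)) (nsnd w) (nsnd (nfst w))) ->
  orec A (fun x => iteri (n x) (fun k v => s k v x) (z x)).
Proof.
move=> Cn [c Ec] [d Ed].
have [e Ee] : orec A (fun w => iteri (nfst w) (fun k v => s k v (nsnd w)) (z (nsnd w))).
  exists (CRec c d) => w.
  rewrite -{1}(npair_nfst_nsnd w).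
  apply: (@ev_rec _ _ _ _ _ (fun k => iteri k (fun k v => s k v (nsnd w)) (z (nsnd w)))).
    exact: Ec.
  move=> m _.
  have := Ed (npair (npair m (nsnd w)) (iteri m (fun k v => s k v (nsnd w)) (z (nsnd w)))).
  by rewrite !nfst_npair !nsnd_npair.
have Ce : orec A (fun w => iteri (nfst w) (fun k v => s k v (nsnd w)) (z (nsnd w))) by exists e.
apply: orec_ext (orec_app1 Ce (orec_pair Cn orec_id)) => x.
by rewrite nfst_npair nsnd_npair.
Qed.

Lemma orec_mu (p : nat -> nat -> nat) (f : nat -> nat) :
  orec2 A p -> (forall x, p (f x) x = 0) ->
  (forall x i, i < f x -> p i x != 0) -> orec A f.
Proof.
case=> c Ec p0 pS; exists (CMu c) => x; apply: ev_mu => [i /pS|].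
  have := Ec (npair i x); rewrite nfst_npair nsnd_npair.
  by case: (p i x) => // v Ev _; exists v.
by have := Ec (npair (f x) x); rewrite nfst_npair nsnd_npair p0.
Qed.

Lemma orec_iter n z s : orec A n -> orec A z ->
  orec A (fun w => s (nsnd w) (nsnd (nfst w))) ->
  orec A (fun x => iter (n x) (fun v => s v x) (z x)).
Proof.
move=> Cn Cz Cs; have := @orec_iteri n z (fun _ v x => s v x) Cn Cz Cs.
by apply: orec_ext => x; elim: (n x) => //= k ->.
Qed.

Definition natcase (a b : nat) (c : nat -> nat) := if a is n.+1 then c n else b.

Lemma orec_natcase a b c : orec A a -> orec A b ->
  orec A (fun w => c (nfst w) (nsnd w)) ->
  orec A (fun x => natcase (a x) (b x) (fun n => c n x)).
Proof.
move=> Ca Cb Cc.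
have := @orec_iteri a b (fun k _ x => c k x) Ca Cb (orec_app1 Cc orec_fst).
by apply: orec_ext => x; case: (a x).
Qed.

Lemma orec_pred : orec A predn.
Proof.
have := @orec_natcase (fun x => x) (fun _ => 0) (fun n _ => n) orec_id (orec_const 0) orec_fst.
by apply: orec_ext; case.
Qed.

Lemma orec_if (b : nat -> bool) c d : orec A (fun x => b x) -> orec A c -> orec A d ->
  orec A (fun x => if b x then c x else d x).
Proof.
move=> Cb Cc Cd.
have := @orec_natcase _ d (fun _ x => c x) Cb Cd (orec_app1 Cc orec_snd).
by apply: orec_ext => x; case: (b x).
Qed.

Lemma orec_add : orec2 A addn.
Proof.
apply: orec_ext (@orec_iter nsnd nfst (fun v _ => v.+1) orec_snd orec_fst
  (orec_app1 orec_succ orec_snd)) => x.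
by elim: (nsnd x) => [|n IH] /=; rewrite ?addn0 // IH addnS.
Qed.

Lemma orec_sub : orec2 A subn.
Proof.
apply: orec_ext (@orec_iter nsnd nfst (fun v _ => v.-1) orec_snd orec_fst
  (orec_app1 orec_pred orec_snd)) => x.
by elim: (nsnd x) => [|n IH] /=; rewrite ?subn0 // IH subnS.
Qed.

Lemma orec_eq0 : orec A (fun x => x == 0).
Proof.
apply: orec_ext (@orec_natcase _ (fun=> 1) (fun _ _ => 0) orec_id (orec_const 1) (orec_const 0)).
by case.
Qed.

Lemma orec_leq a b : orec A a -> orec A b -> orec A (fun x => a x <= b x).
Proof. by move=> Ca Cb; apply: (orec_app1 orec_eq0); apply: orec_app2 orec_sub _ _. Qed.

Lemma orec_negb (b : nat -> bool) : orec A (fun x => b x) -> orec A (fun x => ~~ b x).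
Proof.
move=> Cb; apply: orec_ext (orec_if Cb (orec_const 0) (orec_const 1)) => x.
by case: (b x).
Qed.

Lemma orec_andb (b c : nat -> bool) : orec A (fun x => b x) -> orec A (fun x => c x) ->
  orec A (fun x => b x && c x).
Proof.
move=> Cb Cc; apply: orec_ext (orec_if Cb Cc (orec_const 0)) => x.
by case: (b x).
Qed.

Lemma orec_orb (b c : nat -> bool) : orec A (fun x => b x) -> orec A (fun x => c x) ->
  orec A (fun x => b x || c x).
Proof.
move=> Cb Cc; apply: orec_ext (orec_if Cb (orec_const 1) Cc) => x.
by case: (b x).
Qed.

Lemma orec_eq a b : orec A a -> orec A b -> orec A (fun x => a x == b x).
Proof.
move=> Ca Cb; apply: orec_ext (orec_andb (orec_leq Ca Cb) (orec_leq Cb Ca)) => x.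
by rewrite eqn_leq.
Qed.

End Closure.

Create HintDb orec.
#[export] Hint Resolve orec_succ orec_fst orec_snd orec_pred orec_add orec_sub : orec.

Ltac orec_step :=
  match goal with
  | H : orec ?A ?f |- orec ?A ?f => exact H
  | |- orec _ (fun x => x) => exact: orec_id
  | |- orec _ (fun _ => ?c) => exact: orec_const
  | |- orec _ (fun x => nat_of_bool (@eq_op _ _ _)) => apply: orec_eq
  | |- orec _ (fun x => nat_of_bool (leq _ _)) => apply: orec_leq
  | |- orec _ (fun x => nat_of_bool (~~ _)) => apply: orec_negb
  | |- orec _ (fun x => nat_of_bool (_ && _)) => apply: orec_andb
  | |- orec _ (fun x => nat_of_bool (_ || _)) => apply: orec_orb
  | |- orec _ (fun x => if _ then _ else _) => apply: orec_if
  | |- orec _ (fun x => npair _ _) => apply: orec_pair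
  | |- orec ?A (fun x => natcase (@?a x) (@?b x) (fun n => @?c n x)) =>
     apply: (@orec_natcase A a b c)
  | |- orec ?A (fun x => iteri (@?n x) (fun k v => @?s k v x) (@?z x)) =>
     apply: (@orec_iteri A n z s)
  | |- orec ?A (fun x => iter (@?n x) (fun v => @?s v x) (@?z x)) =>
     apply: (@orec_iter A n z s)
  | |- orec ?A (fun x => iter (@?n x) ?f (@?z x)) =>
     apply: (@orec_iter A n z (fun v _ => f v))
  | |- orec ?A (fun x => ?f (@?a x)) =>
     apply: (@orec_app1 A f a); [solve [eauto with orec]|]
  | |- orec ?A (fun x => ?f (@?a x) (@?b x)) =>
     apply: (@orec_app2 A f a b); [solve [eauto with orec]| |]
  | |- orec ?A (fun x => ?f (@?a x) (@?b x) (@?c x)) =>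
     apply: (@orec_app3 A f a b c); [solve [eauto with orec]| | |]
  | |- orec _ _ => solve [eauto with orec]
  end; cbv beta.
Ltac orec_tac := repeat orec_step.

(** * Coded sequences and indices of codes *)

Notation lc := CodeSeq.code.
Arguments CodeSeq.code : simpl never.
Notation ld := CodeSeq.decode.

Lemma pickle_seq_natE (s : seq nat) : pickle s = lc s.
Proof. by rewrite -[pickle s]/(lc (map (fun x => x) s)) map_id. Qed.

Lemma pickle_pairE (n : nat) (s : seq nat) : pickle (n, s) = lc [:: n; lc s].
Proof. by rewrite -[pickle (n, s)]/(lc [:: n; pickle s]) pickle_seq_natE. Qed.

Lemma pickle_treeE (t : GenTree.tree nat) :
  pickle t = lc (map pickle (GenTree.encode t)).
Proof. by []. Qed.

(** A sum is pickled as a pair of options, and an option as a list of length at most one. *)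
Definition unpickle_sum (j : nat) : option (nat + nat) :=
  if ld j is [:: a; b] then sum_of_opair (ohead (ld a), ohead (ld b)) else None.

Lemma unpickle_sumE j : (unpickle j : option (nat + nat)) = unpickle_sum j.
Proof.
rewrite /unpickle_sum.
have E (m : nat) : unpickle m = Some (ohead (ld m)) :> option (option nat).
  rewrite /unpickle /= /pcomp /= /unpickle_seq /= .
  by rewrite (_ : pmap _ _ = ld m) //; elim: (ld m) => //= a s ->.
rewrite -[LHS]/(obind sum_of_opair (obind (fun y => Some (pair_of_tag y))
   (@unpickle_tagged (option nat) (fun=> option nat) j))) /unpickle_tagged.
by case: (ld j) => [|a [|b [|]]] //; rewrite E (E a).
Qed.

Lemma unpickle_treeE e :
  (unpickle e : option (GenTree.tree nat)) = GenTree.decode (pmap unpickle_sum (ld e)).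
Proof.
rewrite /unpickle /= /pcomp /=. 
by congr GenTree.decode; apply: eq_pmap => j; rewrite -unpickle_sumE.
Qed.

(* These act on codes of sequences; [0] codes [[::]] and [lhd 0 = ltl 0 = 0]. *)
Definition lcons a l := (npair a l).+1.
Definition lhd l := nfst l.-1.
Definition ltl l := nsnd l.-1.
Definition lnth l i := lhd (iter i ltl l).
(** A list is no longer than its code, so it suffices to count the nonempty suffixes among the first
    [l]. *)
Definition lsize l := iteri l (fun k v => v + (iter k ltl l != 0)) 0.
Definition lmk n f := iteri n (fun k v => lcons (f (n - k.+1)) v) 0.
Definition lfoldr (f : nat -> nat -> nat) z l :=
  iteri (lsize l) (fun k v => f (lnth l (lsize l - k.+1)) v) z.
Definition bforall n (p : nat -> nat) := iteri n (fun k v => if p k == 0 then 0 else v) 1.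

Lemma lc_cons a s : lc (a :: s) = lcons a (lc s).
Proof. by rewrite /lcons npairS. Qed.

Lemma nfst0 : nfst 0 = 0. Proof. by []. Qed.
Lemma nsnd0 : nsnd 0 = 0. Proof. by []. Qed.

Lemma lhd_lc s : lhd (lc s) = head 0 s.
Proof. by case: s => [|a s]; rewrite /lhd ?nfst0 // lc_cons nfst_npair. Qed.

Lemma ltl_lc s : ltl (lc s) = lc (behead s).
Proof. by case: s => [|a s]; rewrite /ltl ?nsnd0 // lc_cons nsnd_npair. Qed.

Lemma iter_ltl_lc i s : iter i ltl (lc s) = lc (drop i s).
Proof. by elim: i s => [|i IH] [|a s]; rewrite ?drop0 // iterSr ltl_lc IH. Qed.

Lemma lnth_lc s i : lnth (lc s) i = nth 0 s i.
Proof. by rewrite /lnth iter_ltl_lc lhd_lc -nth0 nth_drop addn0. Qed.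

Lemma lc_eq0 s : (lc s == 0) = (size s == 0).
Proof. by case: s => // a s; rewrite lc_cons. Qed.

Lemma size_le_lc s : size s <= lc s.
Proof.
elim: s => // a s IH; rewrite lc_cons ltnS.
exact: leq_trans IH (leq_npair _ _).
Qed.

Lemma lsize_lc s : lsize (lc s) = size s.
Proof.
rewrite /lsize.
suff H n : iteri n (fun k v => v + (iter k ltl (lc s) != 0)) 0 = minn n (size s).
  by rewrite H; apply/minn_idPr/size_le_lc.
elim: n => [|n IH] /=; first by rewrite min0n.
rewrite IH iter_ltl_lc lc_eq0 size_drop subn_eq0 -ltnNge.
by case: ltnP => h /=; lia.
Qed.

Lemma lmkE n f : lmk n f = lc (mkseq f n).
Proof.
rewrite /lmk /mkseq.
suff H j : j <= n -> iteri j (fun k v => lcons (f (n - k.+1)) v) 0 = lc (map f (iota (n - j) j)).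
  by rewrite H // subnn.
elim: j => // j IH jn; rewrite [LHS]/= IH ?(ltnW jn) // -lc_cons -map_cons.
by congr (lc (map f _)); rewrite /= subnSK.
Qed.

Lemma lfoldrE f z s : lfoldr f z (lc s) = foldr f z s.
Proof.
rewrite /lfoldr lsize_lc.
suff H j : j <= size s -> iteri j (fun k v => f (lnth (lc s) (size s - k.+1)) v) z =
   foldr f z (drop (size s - j) s) by rewrite H // subnn drop0.
elim: j => [|j IH] js; first by rewrite subn0 drop_size.
rewrite [LHS]/= IH ?(ltnW js) // lnth_lc.
have lt : size s - j.+1 < size s by lia.
by rewrite [in RHS](drop_nth 0 lt) /= subnSK.
Qed.

Lemma bforallP n p : reflect (forall k, k < n -> p k != 0) (bforall n p != 0).
Proof.
rewrite /bforall; elim: n => [|n IH] /=; first by left.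
case: ifP => [/eqP pn|pn]; first by right=> /(_ n (ltnSn n)); rewrite pn.
apply: (iffP IH) => H k; last by move=> kn; apply: H; rewrite ltnW.
by rewrite ltnS leq_eqVlt => /orP[/eqP->|/H //]; rewrite pn.
Qed.

Lemma orec_lmk A n f : orec A n -> orec2 A f ->
  orec A (fun x => lmk (n x) (fun i => f i x)).
Proof.
move=> Cn Cf; rewrite /lmk /lcons.
by orec_tac.
Qed.

Lemma orec_lhd A : orec A lhd. Proof. by rewrite /lhd; orec_tac. Qed.
Lemma orec_ltl A : orec A ltl. Proof. by rewrite /ltl; orec_tac. Qed.
Lemma orec_lcons A : orec2 A lcons. Proof. by rewrite /orec2 /lcons; orec_tac. Qed.
#[export] Hint Resolve orec_lhd orec_ltl orec_lcons : orec.
Lemma orec_lnth A : orec2 A lnth. Proof. by rewrite /orec2 /lnth; orec_tac. Qed.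
Lemma orec_lsize A : orec A lsize. Proof. by rewrite /lsize; orec_tac. Qed.
#[export] Hint Resolve orec_lnth orec_lsize : orec.

Lemma orec_lfoldr A f z l : orec A z -> orec A l ->
  orec3 A f ->
  orec A (fun x => lfoldr (fun a v => f a v x) (z x) (l x)).
Proof.
move=> Cz Cl Cf; by rewrite /lfoldr; orec_tac.
Qed.

Lemma orec_bforall A n p : orec A n -> orec2 A p ->
  orec A (fun x => bforall (n x) (fun k => p k x)).
Proof. by move=> Cn Cp; rewrite /bforall; orec_tac. Qed.

Ltac orec_list_step :=
  first [ orec_step |
  match goal with
  | |- orec ?A (fun x => lmk (@?n x) (fun i => @?f i x)) => apply: (@orec_lmk A n f)
  | |- orec ?A (fun x => bforall (@?n x) (fun i => @?f i x)) => apply: (@orec_bforall A n f)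
  | |- orec2 _ _ => rewrite /orec2
  | |- orec3 _ _ => rewrite /orec3
  end; cbv beta].
Ltac orec_list_tac := repeat orec_list_step.

Definition ltake l m := lmk m (fun i => lnth l i).
Lemma ltakeE s m : m <= size s -> ltake (lc s) m = lc (take m s).
Proof.
move=> ms; rewrite /ltake lmkE; congr lc.
apply: (@eq_from_nth _ 0) => [|i]; rewrite size_mkseq; first by rewrite size_takel.
by move=> im; rewrite nth_mkseq // lnth_lc nth_take.
Qed.
Lemma orec_ltake A : orec2 A ltake.
Proof. by rewrite /ltake; orec_list_tac. Qed.
#[export] Hint Resolve orec_ltake : orec.

(* Locked because conversion would otherwise expand the unary numeral 1023. *)
Definition undef_num := locked (npair 10 0).
(** In this numbering the constructor and the subcodes are projections, so [eval] can be unfolded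
    arithmetically. Tag 10 remains for undecodable indices. *)
Fixpoint code_num (c : code) : nat :=
  match c with
  | CZero => npair 0 0
  | CSucc => npair 1 0
  | CId => npair 2 0
  | CFst => npair 3 0
  | COracle => npair 4 0
  | CSnd => npair 5 0
  | CPair f g => npair 6 (npair (code_num f) (code_num g))
  | CComp f g => npair 7 (npair (code_num f) (code_num g))
  | CRec f g => npair 8 (npair (code_num f) (code_num g))
  | CMu f => npair 9 (code_num f)
  end.
Definition ocode_num := oapp code_num undef_num.

Lemma code_num_undef c : (code_num c == undef_num) = false.
Proof. by rewrite /undef_num -lock; apply/eqP; case: c => *; case/npair_inj. Qed.

Definition leafnum x := if x <= 5 then npair x 0 else undef_num.
Definition nodenum n l :=
  if lsize l == 2 then
    if (n <= 2) && ((lnth l 0 != undef_num) && (lnth l 1 != undef_num))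
    then npair (n + 6) (npair (lnth l 0) (lnth l 1)) else undef_num
  else if (lsize l == 1) && ((n == 3) && (lnth l 0 != undef_num)) then npair 9 (lnth l 0)
  else undef_num.

Definition tree_num (t : GenTree.tree nat) := ocode_num (code_of_tree t).

Lemma tree_num_leaf x : tree_num (GenTree.Leaf x) = leafnum x.
Proof. by rewrite /tree_num /leafnum; case: x => [|[|[|[|[|[|x]]]]]]. Qed.

Lemma tree_num_node n ts : tree_num (GenTree.Node n ts) = nodenum n (lc (map tree_num ts)).
Proof.
rewrite /nodenum lsize_lc !lnth_lc size_map.
have definedE o : (ocode_num o != undef_num) = o :> bool.
  by case: o => [c|] //=; rewrite ?code_num_undef ?eqxx.
case: ts => [|t1 [|t2 [|t3 ts]]] //=.
- by rewrite /tree_num /=; case: n => [|[|[|[|n]]]].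
- rewrite /tree_num definedE.
  by case: n => [|[|[|[|n]]]] //=; case: (code_of_tree t1).
- rewrite /tree_num !definedE /=.
  case: (code_of_tree t1) (code_of_tree t2) => [f|] [g|] /=; rewrite ?andbF ?andbT //.
    by case: n => [|[|[|[|n]]]].
  all: by case: n => [|[|[|[|n]]]].
Qed.

(* [GenTree.decode_step], with every tree on the stack replaced by its [tree_num];
   an entry [j] that [unpickle] rejects is skipped. *)
Definition stack_step j st :=
  if lsize j == 2 then
    if lnth j 1 == 0 then
      if lnth j 0 == 0 then st else
      if lhd (lnth j 0) == 0 then npair 0 (lcons (nfst st) (nsnd st))
      else npair (lcons (nodenum (lhd (lnth j 0)).-1 (nfst st)) (lhd (nsnd st))) (ltl (nsnd st))
    else npair (lcons (leafnum (lhd (lnth j 1))) (nfst st)) (nsnd st)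
  else st.

Definition index_num e :=
  (fun st => if nfst st == 0 then undef_num else lhd (nfst st)) (lfoldr stack_step (npair 0 0) e).

Definition stacknum (fs : seq (GenTree.tree nat) * seq (seq (GenTree.tree nat))) :=
  npair (lc (map tree_num fs.1)) (lc (map (fun ts => lc (map tree_num ts)) fs.2)).

Lemma stack_stepE j fs : stack_step j (stacknum fs) =
  stacknum (if unpickle_sum j is Some c then GenTree.decode_step c fs else fs).
Proof.
rewrite /unpickle_sum; move: (CodeSeq.decodeK j).
case: (ld j) => [|a [|b [|c s]]] <-; rewrite /stack_step lsize_lc [size _]/=; [by []|by []| |by []].
rewrite eqxx !lnth_lc [nth _ _ 0]/= [nth _ _ 1]/=.
rewrite /stacknum nfst_npair nsnd_npair; move: (CodeSeq.decodeK b).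
case: (ld b) => [|x b'] <-; rewrite lc_eq0 /=; last by rewrite lhd_lc tree_num_leaf [in RHS]lc_cons.
move: (CodeSeq.decodeK a); case: (ld a) => [|n a'] <-; rewrite lc_eq0 //=.
rewrite lhd_lc /=; case: n => [|n] /=; first by rewrite [in RHS]lc_cons.
rewrite ltl_lc lc_cons tree_num_node behead_map; congr (npair (lcons _ _) _).
by case: fs => l [|M fs]; rewrite lhd_lc.
Qed.

Lemma index_numE e : index_num e = ocode_num (decode e).
Proof.
rewrite /index_num /decode unpickle_treeE /GenTree.decode.
set fs := foldr _ _ (pmap _ _).
have -> : lfoldr stack_step (npair 0 0) e = stacknum fs.
  rewrite -{1}[e]CodeSeq.decodeK lfoldrE {}/fs; elim: (ld e) => //= j s ->.
  by rewrite stack_stepE; case: (unpickle_sum j).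
by rewrite nfst_npair lc_eq0 size_map lhd_lc; case: (fs.1).
Qed.

Lemma orec_index_num A : orec A index_num.
Proof.
have C1 : orec2 A nodenum by rewrite /orec2 /nodenum; orec_tac.
have C2 : orec A leafnum by rewrite /leafnum; orec_tac.
have C3 : orec2 A stack_step by rewrite /orec2 /stack_step; orec_tac.
have C4 : orec A (lfoldr stack_step (npair 0 0)).
  apply: (@orec_lfoldr A (fun a v _ => stack_step a v) (fun=> npair 0 0) (fun x => x)); orec_tac.
  by rewrite /orec3; orec_tac.
by rewrite /index_num; orec_tac.
Qed.
#[export] Hint Resolve orec_index_num : orec.

(** * Indices of codes and the s-m-n theorem *)

Fixpoint tree_of_code (c : code) : GenTree.tree nat :=
  match c with
  | CZero => GenTree.Leaf 0
  | CSucc => GenTree.Leaf 1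
  | CId => GenTree.Leaf 2
  | CFst => GenTree.Leaf 3
  | COracle => GenTree.Leaf 4
  | CSnd => GenTree.Leaf 5
  | CPair f g => GenTree.Node 0 [:: tree_of_code f; tree_of_code g]
  | CComp f g => GenTree.Node 1 [:: tree_of_code f; tree_of_code g]
  | CRec f g => GenTree.Node 2 [:: tree_of_code f; tree_of_code g]
  | CMu f => GenTree.Node 3 [:: tree_of_code f]
  end.
Definition code_index c := pickle (tree_of_code c).

Lemma code_of_tree_of_code c : code_of_tree (tree_of_code c) = Some c.
Proof. by elim: c => //= [f -> g ->|f -> g ->|f -> g ->|f ->]. Qed.

Lemma decode_code_index c : decode (code_index c) = Some c.
Proof. by rewrite /decode /code_index pickleK code_of_tree_of_code. Qed.

Lemma phi_ev A e c x y : decode e = Some c -> (phi A e x y <-> ev A c x y).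
Proof.
move=> dec; split=> [[k [c' []]]|[k Ek]]; last by exists k, c.
by rewrite dec => -[<-] Ek; exists k.
Qed.

Lemma orec_computable A f : orec A f <-> computable_in A f.
Proof.
split=> [[c Ec]|[e Ee]].
  by exists (code_index c) => x; apply/(phi_ev _ _ _ (decode_code_index c)).
case: (Ee 0) => k [c [dec _]]; exists c => x.
exact/(phi_ev _ _ _ dec).
Qed.

Lemma ev_compE A f g x y z : ev A g x y -> (ev A (CComp f g) x z <-> ev A f y z).
Proof.
move=> Eg; split=> [[[|k] //]|]; last exact: ev_comp.
rewrite evalS; case E: (eval A k g x) => [y'|] //= Ef.
by rewrite (ev_inj Eg (ex_intro _ k E)); exists k.
Qed.

Definition constc n := iter n (CComp CSucc) CZero.

Lemma ev_constc A n x : ev A (constc n) x n.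
Proof.
elim: n => [|n IH]; first by exists 1.
by apply: ev_comp IH _; exists 1.
Qed.

Definition smn c n := code_index (CComp c (CPair (constc n) CId)).

Lemma phi_smn A c n x y : phi A (smn c n) x y <-> ev A c (npair n x) y.
Proof.
rewrite phi_ev; last exact: decode_code_index.
by apply: ev_compE; apply: ev_pair (ev_constc _ _ _) _; exists 1.
Qed.

Definition lapp s l := foldr lcons l s.

Lemma lc_cat s t : lc (s ++ t) = lapp s (lc t).
Proof. by elim: s => //= a s <-; rewrite -lc_cons. Qed.

Lemma orec_lapp A s : orec A (lapp s).
Proof. by rewrite /lapp; elim: s => [|a s IH] /=; orec_tac. Qed.
#[export] Hint Resolve orec_lapp : orec.

(** Each successor in [constc n] contributes a fixed prefix and one closing mark [inl 0], so the
    code arises by iterating two prepending maps. *)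
Lemma lc_encode_constc (pk : nat + nat -> nat) n R :
  lc (map pk (GenTree.encode (tree_of_code (constc n)) ++ R)) =
  iter n (lapp (map pk [:: inl 2; inr 1]))
    (lcons (pk (inr 0)) (iter n (lcons (pk (inl 0))) (lc (map pk R)))).
Proof.
elim: n R => [|n IH] R; first by rewrite -lc_cons.
rewrite iterS [iter n.+1 (lcons _) _]iterSr -lc_cons -(map_cons pk) -IH -lc_cat -map_cat.
by congr (lc (map pk _)); rewrite /= cats0 -cats1 -catA.
Qed.

Lemma orec_smn A c : orec A (smn c).
Proof.
pose L : seq (nat + nat) := [:: inl 2] ++ GenTree.encode (tree_of_code c) ++ [:: inl 1].
pose Q : seq (nat + nat) := [:: inr 2; inl 0; inl 0].
have E n : smn c n = lc (map pickle (L ++ (GenTree.encode (tree_of_code (constc n)) ++ Q))).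
  rewrite /smn /code_index pickle_treeE; congr (lc (map _ _)).
  by rewrite /L /= -!cats1 /= !cats0 -!catA /= -!catA.
(* Only the arrangement of the letters depends on [n]; their pickled values are constants, so an
   arbitrary [pk] will do. *)
suff H (pk : nat + nat -> nat) :
    orec A (fun n => lc (map pk (L ++ (GenTree.encode (tree_of_code (constc n)) ++ Q)))).
  by apply: orec_ext (H pickle) => n; rewrite E.
apply: orec_ext (fun n => lapp (map pk L) (iter n (lapp (map pk [:: inl 2; inr 1]))
  (lcons (pk (inr 0)) (iter n (lcons (pk (inl 0))) (lc (map pk Q)))))) _ _ _.
  by move=> n; rewrite map_cat lc_cat lc_encode_constc.
by orec_tac.
Qed.
#[export] Hint Resolve orec_smn : orec.

(** * Computable functionals *)

Notation orec0 := (orec empty_oracle).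

Definition init_code (g : nat -> nat) m := lc [seq g i | i <- iota 0 m].

(* [phi] sees a finite initial segment of [g]: the value 0 means that the segment is
   too short, and [v.+1] that the result is [v]. *)
Definition frec (F : (nat -> nat) -> nat -> nat) :=
  exists2 phi : nat -> nat -> nat, orec2 empty_oracle phi & forall g x,
    (forall m, phi (init_code g m) x = 0 \/ phi (init_code g m) x = (F g x).+1) /\
    exists m0, forall m, m0 <= m -> phi (init_code g m) x = (F g x).+1.

Lemma frec_ext F G : (forall g x, F g x = G g x) -> frec F -> frec G.
Proof.
by move=> e [p Cp H]; exists p => // g x; rewrite -e; apply: H.
Qed.

Lemma frec_base f : orec0 f -> frec (fun _ x => f x).
Proof.
move=> Cf; exists (fun _ x => (f x).+1); first by rewrite /orec2; orec_tac.
by move=> g x; split; [right | exists 0].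
Qed.

Lemma frec_app F G : frec F -> frec G -> frec (fun g x => F g (G g x)).
Proof.
case=> p Cp Hp [q Cq Hq].
exists (fun l x => natcase (q l x) 0 (fun y => p l y)); first by rewrite /orec2; orec_tac.
move=> g x; have [Hq0 [m1 Hq1]] := Hq g x; have [Hp0 [m2 Hp1]] := Hp g (G g x); split.
  by move=> m; case: (Hq0 m) => -> /=; [left | apply: Hp0].
exists (maxn m1 m2) => m; rewrite geq_max => /andP[h1 h2].
by rewrite Hq1 //= Hp1.
Qed.

Lemma frec_pair F G : frec F -> frec G -> frec (fun g x => npair (F g x) (G g x)).
Proof.
case=> p Cp Hp [q Cq Hq].
exists (fun l x => natcase (p l x) 0 (fun a => natcase (q l x) 0 (fun b => (npair a b).+1))).
  by rewrite /orec2; orec_tac.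
move=> g x; have [Hp0 [m1 Hp1]] := Hp g x; have [Hq0 [m2 Hq1]] := Hq g x; split.
  by move=> m; case: (Hp0 m) => -> /=; [left | case: (Hq0 m) => -> /=; [left | right]].
exists (maxn m1 m2) => m; rewrite geq_max => /andP[h1 h2].
by rewrite Hp1 //= Hq1.
Qed.

Lemma frec_lookup : frec (fun g x => g x).
Proof.
exists (fun l x => if x < lsize l then (lnth l x).+1 else 0).
  by rewrite /orec2; orec_tac.
move=> g x.
have H m : (if x < lsize (init_code g m) then (lnth (init_code g m) x).+1 else 0) =
    if x < m then (g x).+1 else 0.
  rewrite lsize_lc size_map size_iota lnth_lc; case: ifP => // xm.
  by rewrite (nth_map 0) ?size_iota // nth_iota.
split=> [m|]; first by rewrite H; case: ifP; [right | left].
by exists x.+1 => m xm; rewrite H xm.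
Qed.

Lemma frec_look F : frec F -> frec (fun g x => g (F g x)).
Proof. exact: frec_app frec_lookup. Qed.

Lemma frec_id : frec (fun _ x => x).
Proof. by apply: frec_base; orec_tac. Qed.

Lemma frec_const n : frec (fun _ _ => n).
Proof. by apply: frec_base; orec_tac. Qed.

Lemma frec_app1 f F : orec0 f -> frec F -> frec (fun g x => f (F g x)).
Proof. by move=> Cf CF; apply: (frec_app (frec_base Cf)). Qed.

Lemma frec_app2 f F G : orec2 empty_oracle f -> frec F -> frec G ->
  frec (fun g x => f (F g x) (G g x)).
Proof.
move=> Cf CF CG; apply: frec_ext (frec_app1 Cf (frec_pair CF CG)) => g x.
by rewrite nfst_npair nsnd_npair.
Qed.

Lemma frec_iteri n z s : frec n -> frec z ->
  frec (fun g w => s g (nfst (nfst w)) (nsnd w) (nsnd (nfst w))) ->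
  frec (fun g x => iteri (n g x) (fun k v => s g k v x) (z g x)).
Proof.
case=> p Cp Hp [q Cq Hq] [r Cr Hr].
(* State 0 means that some step found the segment too short, and it persists; [v.+1] carries the
   current value [v]. *)
pose it l x a b := iteri a (fun k v => natcase v 0 (fun w => r l (npair (npair k x) w))) b.+1.
exists (fun l x => natcase (p l x) 0 (fun a => natcase (q l x) 0 (fun b => it l x a b))).
  by rewrite /orec2 /it; orec_tac.
move=> g x; have [Hp0 [m1 Hp1]] := Hp g x; have [Hq0 [m2 Hq1]] := Hq g x.
have E k v : s g (nfst (nfst (npair (npair k x) v))) (nsnd (npair (npair k x) v))
    (nsnd (nfst (npair (npair k x) v))) = s g k v x.
  by rewrite !nfst_npair !nsnd_npair.
split.
  move=> m; case: (Hp0 m) => -> /=; first by left.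
  case: (Hq0 m) => -> /=; first by left.
  rewrite /it; elim: (n g x) => [|k IH] /=; first by right.
  case: IH => -> /=; first by left.
  by rewrite -E; case: (Hr g (npair (npair k x) (iteri k (fun k v => s g k v x) (z g x)))).
have [m3 Hm3] : exists m3, forall m, m3 <= m -> it (init_code g m) x (n g x) (z g x) =
    (iteri (n g x) (fun k v => s g k v x) (z g x)).+1.
  rewrite /it; elim: (n g x) => [|k [m3 IH]] /=; first by exists 0.
  case: (Hr g (npair (npair k x) (iteri k (fun k v => s g k v x) (z g x)))) => _ [m4 H4].
  exists (maxn m3 m4) => m; rewrite geq_max => /andP[h3 h4].
  by rewrite IH //= H4 // E.
exists (maxn m1 (maxn m2 m3)) => m; rewrite !geq_max => /and3P[h1 h2 h3].
by rewrite Hp1 //= Hq1 //= Hm3.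
Qed.

Lemma frec_natcase a b c : frec a -> frec b ->
  frec (fun g w => c g (nfst w) (nsnd w)) ->
  frec (fun g x => natcase (a g x) (b g x) (fun n => c g n x)).
Proof.
move=> Ca Cb Cc.
have := @frec_iteri a b (fun g k _ x => c g k x) Ca Cb (frec_app Cc (frec_base (orec_fst _))).
by apply: frec_ext => g x; case: (a g x).
Qed.

Lemma frec_if (b : (nat -> nat) -> nat -> bool) c d :
  frec (fun g x => b g x) -> frec c -> frec d ->
  frec (fun g x => if b g x then c g x else d g x).
Proof.
move=> Cb Cc Cd.
have := @frec_natcase _ d (fun g _ x => c g x) Cb Cd (frec_app Cc (frec_base (orec_snd _))).
by apply: frec_ext => g x; case: (b g x).
Qed.

Lemma frec_eq F G : frec F -> frec G -> frec (fun g x => F g x == G g x).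
Proof.
have C : orec2 empty_oracle (fun a b => a == b) by rewrite /orec2; orec_tac.
exact: frec_app2 C.
Qed.

Lemma frec_negb (b : (nat -> nat) -> nat -> bool) :
  frec (fun g x => b g x) -> frec (fun g x => ~~ b g x).
Proof.
move=> Cb; apply: frec_ext (frec_if Cb (frec_const 0) (frec_const 1)) => g x.
by case: (b g x).
Qed.

Lemma frec_andb (b c : (nat -> nat) -> nat -> bool) :
  frec (fun g x => b g x) -> frec (fun g x => c g x) -> frec (fun g x => b g x && c g x).
Proof.
move=> Cb Cc; apply: frec_ext (frec_if Cb Cc (frec_const 0)) => g x.
by case: (b g x).
Qed.

Lemma frec_orb (b c : (nat -> nat) -> nat -> bool) :
  frec (fun g x => b g x) -> frec (fun g x => c g x) -> frec (fun g x => b g x || c g x).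
Proof.
move=> Cb Cc; apply: frec_ext (frec_if Cb (frec_const 1) Cc) => g x.
by case: (b g x).
Qed.

Lemma frec_bif (b c d : (nat -> nat) -> nat -> bool) :
  frec (fun g x => b g x) -> frec (fun g x => c g x) -> frec (fun g x => d g x) ->
  frec (fun g x => if b g x then c g x else d g x : bool).
Proof.
move=> Cb Cc Cd; apply: frec_ext (frec_if Cb Cc Cd) => g x.
by case: (b g x).
Qed.

Ltac frec_step :=
  match goal with
  | |- frec _ => assumption
  | |- frec (fun _ x => x) => exact: frec_id
  | |- frec (fun _ _ => ?c) => exact: frec_const
  | |- frec (fun g x => nat_of_bool (@eq_op _ _ _)) => apply: frec_eq
  | |- frec (fun g x => nat_of_bool (~~ _)) => apply: frec_negb
  | |- frec (fun g x => nat_of_bool (_ && _)) => apply: frec_andb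
  | |- frec (fun g x => nat_of_bool (_ || _)) => apply: frec_orb
  | |- frec (fun g x => if _ then _ else _) => apply: frec_if
  | |- frec (fun g x => nat_of_bool (if _ then _ else _)) => apply: frec_bif
  | |- frec (fun g x => npair _ _) => apply: frec_pair
  | |- frec (fun g x => g (@?a g x)) => apply: (@frec_look a)
  | |- frec (fun g x => natcase (@?a g x) (@?b g x) (fun n => @?c g n x)) =>
     apply: (@frec_natcase a b c)
  | |- frec (fun g x => iteri (@?n g x) (fun k v => @?s g k v x) (@?z g x)) =>
     apply: (@frec_iteri n z s)
  | |- frec (fun g x => ?f (@?a g x)) =>
     apply: (@frec_app1 f a); [solve [eauto with orec]|]
  | |- frec (fun g x => ?f (@?a g x) (@?b g x)) =>
     apply: (@frec_app2 f a b); [solve [eauto with orec]| |]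
  end; cbv beta.
Ltac frec_tac := repeat frec_step.

(* The length of the initial segment doubles as the universally quantified number:
   every [x] is [nfst] of arbitrarily large lengths. *)
Lemma frec_nf F : frec F -> exists2 rho : nat -> nat -> nat, orec2 empty_oracle rho &
  forall n g, (forall x, F g (npair n x) != 0) <-> (forall m, rho n (init_code g m) != 0).
Proof.
case=> p Cp Hp; exists (fun n l => p l (npair n (nfst (lsize l))) != 1).
  by rewrite /orec2; orec_tac.
move=> n g; split=> H.
  move=> m; set x := npair _ _; have [+ _] := Hp g x.
  by case/(_ m)=> -> //; have := H (nfst (lsize (init_code g m))); rewrite -/x; case: (F g x).
move=> x; have [_ [m0 Hm]] := Hp g (npair n x).
have := H (npair x m0); rewrite lsize_lc size_map size_iota nfst_npair Hm ?leq_npair //.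
by case: (F _ _).
Qed.

(** * Tables of values of eval *)

(* One unfolding of [eval] on code numbers, with 0 for [None] and [v.+1] for [Some v];
   [a] is the oracle's answer at [x] and [v] the evaluation with fuel [k].  In the search
   loop the state 0 means running, 1 means undefined, and [i.+2] means found [i]. *)
Definition eval_unfold (a : nat) (v : nat -> nat -> nat) k c x :=
  if nfst c == 0 then 1 else if nfst c == 1 then x.+2 else if nfst c == 2 then x.+1 else
  if nfst c == 3 then (nfst x).+1 else if nfst c == 4 then a.+1 else
  if nfst c == 5 then (nsnd x).+1 else
  if nfst c == 6 then
    natcase (v (nfst (nsnd c)) x) 0 (fun r =>
      natcase (v (nsnd (nsnd c)) x) 0 (fun s => (npair r s).+1)) else
  if nfst c == 7 then natcase (v (nsnd (nsnd c)) x) 0 (fun y => v (nfst (nsnd c)) y) else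
  if nfst c == 8 then
    iteri (nfst x)
      (fun m r => natcase r 0 (fun w => v (nsnd (nsnd c)) (npair (npair m (nsnd x)) w)))
      (v (nfst (nsnd c)) (nsnd x)) else
  if nfst c == 9 then
    (iteri k (fun i r => if r == 0 then
       natcase (v (nsnd c) (npair i x)) 1 (fun w => if w == 0 then i.+2 else 0) else r) 0).-1
  else 0.

Fixpoint evalN (A : nat -> bool) k c x :=
  if k is k'.+1 then eval_unfold (A x) (evalN A k') k' c x else 0.

Definition oenc (o : option nat) := if o is Some v then v.+1 else 0.

Lemma eval_unfold_ext a v v' k c x : (forall c x, v c x = v' c x) ->
  eval_unfold a v k c x = eval_unfold a v' k c x.
Proof.
move=> e; rewrite /eval_unfold !e.
do 6 (case: ifP => // _).
case: ifP => _; first by case: (v' _ x) => //= n; rewrite ?e.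
case: ifP => _; first by case: (v' _ x) => //= n; rewrite ?e.
case: ifP => _; last case: ifP => // _.
  by elim: (nfst x) => //= n ->; rewrite /natcase; case: (iteri _ _ _).
by congr predn; elim: k => //= n ->; rewrite e.
Qed.

Lemma evalN_code_num A k c x : evalN A k (code_num c) x = oenc (eval A k c x).
Proof.
elim: k c x => // k IH c x; rewrite evalS [LHS]/=.
case: c => [||||||f g|f g|f g|f]; rewrite /eval_unfold !nfst_npair //=.
- rewrite !nsnd_npair !nfst_npair !IH.
  by case: (eval A k f x) => //= a; case: (eval A k g x).
- rewrite !nsnd_npair !nfst_npair !IH.
  by case: (eval A k g x) => //= a; rewrite IH.
- rewrite !nsnd_npair !nfst_npair !IH.
  elim: (nfst x) => //= n ->; case: (rec_loop _ _ _ n) => //= v; exact: IH.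
- rewrite !nsnd_npair.
  set st := fun i r => _.
  (* Every nonzero state of the search is final. *)
  have stuck b r : r != 0 -> forall i, iteri b (fun j => st (i + j)) r = r.
    by move=> r0 i; elim: b => //= b ->; rewrite /st (negPf r0).
  suff H b i : (iteri b (fun j => st (i + j)) 0).-1 = oenc (mu_loop (eval A k f) x i b).
    exact: (H k 0).
  elim: b i => // b IHb i.
  (* [iteri] unfolds at its last step but the search at its first, so the first step is split
     off. *)
  have iteriSr n h z : iteri n.+1 h z = iteri n (fun j => h j.+1) (h 0 z).
    by elim: n => //= n <-.
  rewrite iteriSr addn0.
  have -> : iteri b (fun j => st (i + j.+1)) (st i 0) = iteri b (fun j => st (i.+1 + j)) (st i 0).
    by elim: b {IHb} => //= b ->; rewrite addSnnS.
  rewrite {2}/st /= IH.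
  case: (eval A k f (npair i x)) => [[|v]|] /=; [by rewrite stuck | exact: IHb | by rewrite stuck].
Qed.

Lemma evalN_undef_num A k x : evalN A k undef_num x = 0.
Proof. by case: k => //= k; rewrite /eval_unfold /undef_num -lock nfst_npair. Qed.

Lemma phi_evalN A e x y : phi A e x y <-> exists k, evalN A k (index_num e) x = y.+1.
Proof.
rewrite index_numE; case dec: (decode e) => [c|] /=; last first.
  split=> [[k [c []]]|[k]]; by [rewrite dec | rewrite evalN_undef_num].
rewrite phi_ev; last exact: dec.
split=> -[k Ek]; exists k; first by rewrite evalN_code_num Ek.
by move: Ek; rewrite evalN_code_num; case: eval => //= v [->].
Qed.

(* [g] is read as a family of tables: [eval_table] gives the values of [eval] and
   [halt_table] is 0 on divergence and [k.+1] on convergence with fuel [k].  The index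
   [o] selects the oracle: empty for 0, the halting set otherwise. *)
Definition eval_table (g : nat -> nat) o k c x := g (npair 0 (npair o (npair k (npair c x)))).
Definition halt_table (g : nat -> nat) o c x := g (npair 1 (npair o (npair c x))).
Definition table_oracle g o x :=
  if o == 0 then 0 else nat_of_bool (halt_table g 0 (index_num x) x != 0).
(* On divergence the fuel is [0.-1 = 0], which makes the value 0. *)
Definition eval_value g o e x :=
  eval_table g o (halt_table g o (index_num e) x).-1 (index_num e) x.

(** The first conjunct determines the table of [eval] by recursion on the fuel. The second makes
    [halt_table] decide halting; on convergence it names a sufficient fuel, so no existential number
    quantifier arises. *)
Definition eval_world_at g o k c x :=
  (eval_table g o k c x ==
     natcase k 0 (fun k' => eval_unfold (table_oracle g o x) (eval_table g o k') k' c x)) &&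
  (if halt_table g o c x == 0 then eval_table g o k c x == 0
   else eval_table g o (halt_table g o c x).-1 c x != 0).

Definition eval_world g := forall o k c x, eval_world_at g o k c x.

Definition jump_oracle o := if o == 0 then empty_oracle else halting_oracle.

Section EvalWorld.
Variable g : nat -> nat.
Hypothesis Bg : eval_world g.

Lemma eval_table0 o c x : eval_table g o 0 c x = 0.
Proof. by have /andP[/eqP] := Bg o 0 c x. Qed.

Lemma eval_tableS o k c x :
  eval_table g o k.+1 c x = eval_unfold (table_oracle g o x) (eval_table g o k) k c x.
Proof. by have /andP[/eqP] := Bg o k.+1 c x. Qed.

Lemma halt_tableP o c x : (halt_table g o c x != 0) <-> exists k, eval_table g o k c x != 0.
Proof.
split=> [h|[k]].
  exists (halt_table g o c x).-1; have /andP[_] := Bg o 0 c x.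
  by rewrite (negPf h).
by apply: contra => h; have /andP[_] := Bg o k c x; rewrite h.
Qed.

Lemma eval_table_evalN (o : nat) (A : nat -> bool) :
  (forall x, table_oracle g o x = A x) -> forall k c x, eval_table g o k c x = evalN A k c x.
Proof.
move=> HA; elim=> [|k IH] c x; first exact: eval_table0.
by rewrite eval_tableS HA; apply: eval_unfold_ext.
Qed.

(** The oracle of index 0 does not consult [halt_table], so that table of [eval] is correct first;
    its [halt_table] then decides the halting problem, which is the oracle of every other index. *)
Lemma table_oracleE o x : table_oracle g o x = jump_oracle o x.
Proof.
rewrite /table_oracle /jump_oracle; case: eqP => // _; congr nat_of_bool.
have eval_tableE := eval_table_evalN (o := 0) (A := empty_oracle) (fun _ => erefl).
rewrite /halting_oracle; case: excluded_middle_informative => h.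
  apply: (proj2 (halt_tableP _ _ _)); case: h => y /phi_evalN[k Ek]; exists k.
  by rewrite eval_tableE Ek.
apply/negbTE/negP=> /halt_tableP[k]; rewrite eval_tableE; case E: evalN => [|y] // _.
by case: h; exists y; apply/phi_evalN; exists k.
Qed.

Lemma eval_tableE o k c x : eval_table g o k c x = evalN (jump_oracle o) k c x.
Proof. exact/eval_table_evalN/table_oracleE. Qed.

Lemma eval_valueP o e x v : eval_value g o e x = v.+1 <-> phi (jump_oracle o) e x v.
Proof.
have sound w : eval_value g o e x = w.+1 -> phi (jump_oracle o) e x w.
  rewrite /eval_value eval_tableE => h; apply/phi_evalN.
  by exists (halt_table g o (index_num e) x).-1.
split; first exact: sound.
move=> p; case/phi_evalN: (p) => k Ek.
have /halt_tableP h : exists k, eval_table g o k (index_num e) x != 0.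
  by exists k; rewrite eval_tableE Ek.
have: eval_value g o e x != 0.
  by have /andP[_] := Bg o 0 (index_num e) x; rewrite (negPf h).
case E: (eval_value g o e x) => [|w] // _; congr S.
have := sound _ E; case=> k1 [c [dec E1]]; case: p => k2 [c2 []]; rewrite dec => -[<-] E2.
exact: ev_inj (ex_intro _ k1 E1) (ex_intro _ k2 E2).
Qed.

End EvalWorld.

(** The sufficient fuels come from classical choice. The conditions constrain only tables 0 and 1,
    so all later tables are free to store witnesses [u]. *)
Lemma eval_world_exists (u : nat -> nat -> nat) :
  exists2 g, eval_world g & forall j y, g (npair j.+2 y) = u j y.
Proof.
pose hv o c x :=
  if excluded_middle_informative (exists k, evalN (jump_oracle o) k c x != 0) is left h
  then (proj1_sig (constructive_indefinite_description _ h)).+1 else 0.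
pose g y := if nfst y is j.+1 then if j is j'.+1 then u j' (nsnd y)
     else hv (nfst (nsnd y)) (nfst (nsnd (nsnd y))) (nsnd (nsnd (nsnd y)))
   else evalN (jump_oracle (nfst (nsnd y))) (nfst (nsnd (nsnd y)))
          (nfst (nsnd (nsnd (nsnd y)))) (nsnd (nsnd (nsnd (nsnd y)))).
exists g; last by move=> j y; rewrite /g nfst_npair nsnd_npair.
have eval_tableE o k c x : eval_table g o k c x = evalN (jump_oracle o) k c x.
  by rewrite /eval_table /g !(nfst_npair, nsnd_npair).
have HE o c x : halt_table g o c x = hv o c x by rewrite /halt_table /g !(nfst_npair, nsnd_npair).
have oE o x : table_oracle g o x = jump_oracle o x.
  rewrite /table_oracle /jump_oracle; case: eqP => // _; congr nat_of_bool.
  rewrite HE /hv /halting_oracle.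
  case: excluded_middle_informative => h1; case: excluded_middle_informative => h2 //.
    case: h2; case: h1 => k; case E: evalN => [|y] // _; exists y.
    by apply/phi_evalN; exists k.
  case: h1; case: h2 => y /phi_evalN[k Ek]; exists k.
  by rewrite Ek.
move=> o k c x; apply/andP; split.
  rewrite eval_tableE; case: k => //= k; apply/eqP; rewrite oE.
  by apply: eval_unfold_ext => *; rewrite eval_tableE.
rewrite !HE !eval_tableE /hv; case: excluded_middle_informative => h /=.
  by case: constructive_indefinite_description.
by apply/eqP; case E: evalN => [|y] //; case: h; exists k; rewrite E.
Qed.

(* [fun e => eval_value g 1 e e] differs at [e] from the function with index [e]. *)
Lemma eval_world_not_0jump g : eval_world g -> ~ zero_jump_computable g.
Proof.
move=> Bg /orec_computable Cg.
have /orec_computable[e Ee] : orec halting_oracle (fun e => eval_value g 1 e e).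
  by rewrite /eval_value /eval_table /halt_table; orec_tac.
by have /(eval_valueP Bg 1) := Ee e; lia.
Qed.

Lemma frec_eval_value o c x : frec o -> frec c -> frec x ->
  frec (fun g z => eval_value g (o g z) (c g z) (x g z)).
Proof. by move=> *; rewrite /eval_value /eval_table /halt_table; frec_tac. Qed.

Lemma frec_eval_world_at o k c x : frec o -> frec k -> frec c -> frec x ->
  frec (fun g z => eval_world_at g (o g z) (k g z) (c g z) (x g z)).
Proof.
move=> Co Ck Cc Cx.
suff C : frec (fun g z => eval_world_at g (nfst z) (nfst (nsnd z))
    (nfst (nsnd (nsnd z))) (nsnd (nsnd (nsnd z)))).
  apply: frec_ext (frec_app C (frec_pair Co (frec_pair Ck (frec_pair Cc Cx)))) => g z.
  by rewrite !(nfst_npair, nsnd_npair).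
by rewrite /eval_world_at /eval_unfold /table_oracle /eval_table /halt_table; frec_tac.
Qed.

(** * The index set is Pi^1_1 *)

(** Passing to the complement turns Kleene normal form into an existential function quantifier, with
    [frec_nf] absorbing the universal number quantifier. *)
Lemma Pi11_of_functional (X : nat -> Prop) F : frec F ->
  (forall n, ~ X n <-> exists g, forall x, F g (npair n x) != 0) -> Pi11 X.
Proof.
move=> /frec_nf[rho Cr Hr] HX; exists (fun z => rho (lnth z 0) (lnth z 1)); split.
  by apply/orec_computable; orec_tac.
have E n g m : lnth (pickle (n, [seq g i | i <- iota 0 m])) 0 = n /\
               lnth (pickle (n, [seq g i | i <- iota 0 m])) 1 = init_code g m.
  by rewrite pickle_pairE !lnth_lc.
move=> n; split=> [Xn g|H].
  case: (classic (exists m, rho n (init_code g m) = 0)) => [[m Em]|no].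
    by exists m; have [-> ->] := E n g m.
  have: ~ X n; last by [].
  apply/HX; exists g; apply/Hr => m; apply/eqP => h; case: no; by exists m.
apply: NNPP => /HX[g] /Hr h.
by have [m] := H g; have [-> ->] := E n g m; have := h m; case: (rho _ _).
Qed.

(** * Embeddings between indexed structures as conditions on the tables *)

Definition lmap (f : nat -> nat) l := lmk (lsize l) (fun i => f (lnth l i)).

Lemma lmapE f s : lmap f (lc s) = lc (map f s).
Proof.
rewrite /lmap lmkE lsize_lc; congr lc; apply: (@eq_from_nth _ 0).
  by rewrite size_mkseq size_map.
by move=> i; rewrite size_mkseq => h; rewrite nth_mkseq // lnth_lc (nth_map 0).
Qed.

Lemma frec_lmap (f : (nat -> nat) -> nat -> nat -> nat) l : frec l ->
  frec (fun g w => f g (nfst w) (nsnd w)) ->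
  frec (fun g x => lmap (fun i => f g i x) (l g x)).
Proof.
move=> Cl Cf; rewrite /lmap /lmk; frec_tac.
have h : frec (fun g w => npair (lnth (l g (nsnd (nfst w)))
    (lsize (l g (nsnd (nfst w))) - (nfst (nfst w)).+1)) (nsnd (nfst w))).
  frec_tac; apply: (frec_app Cl); frec_tac.
by apply: frec_ext (frec_app Cf h) => g w; rewrite !(nfst_npair, nsnd_npair).
Qed.

Definition isbit v := (v == 1) || (v == 2).
Definition atom i s := lcons i (lcons s 0).

Lemma atomE i s : atom i (lc s) = pickle (i, s).
Proof. by rewrite pickle_pairE !lc_cons. Qed.

(** [d] stands for [eval_value g]; its first argument is 0 here because structures are computed with
    the empty oracle, and [s] is a list code. *)
Definition emb_at (d : nat -> nat -> nat -> nat) p q (f : nat -> nat) x y i s :=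
  ((f x != f y) || (x == y)) && (d 0 p (atom i s) == d 0 q (atom i (lmap f s))).

(* A witness that [e] does not compute an embedding of structure [p] in structure [q].
   Where [e] diverges at an entry of [s] the last disjunct is meaningless, but then it is
   true anyway that [e] computes no embedding. *)
Definition bad_at (d : nat -> nat -> nat -> nat) p q e x y i s :=
  (d 1 e x == 0) || ((x != y) && (d 1 e x == d 1 e y)) ||
  (d 0 p (atom i s) != d 0 q (atom i (lmap (fun z => (d 1 e z).-1) s))).

Section Satisfaction.
Variable g : nat -> nat.
Hypothesis Bg : eval_world g.

Lemma isbitP p x : isbit (eval_value g 0 p x) <-> exists b, b <= 1 /\ phi0 p x b.
Proof.
split=> [/orP[]/eqP /(eval_valueP Bg 0) h|[[|[|b]] []// _ /(eval_valueP Bg 0) ->] //].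
  by exists 0.
by exists 1.
Qed.

Lemma struct_ofE p i s : struct_of p i s <-> eval_value g 0 p (atom i (lc s)) = 2.
Proof. by rewrite atomE; split=> /(eval_valueP Bg 0). Qed.

Lemma bit_eq p q x y : isbit (eval_value g 0 p x) -> isbit (eval_value g 0 q y) ->
  (eval_value g 0 p x == eval_value g 0 q y) <->
  (eval_value g 0 p x = 2 <-> eval_value g 0 q y = 2).
Proof.
move=> /orP[]/eqP-> /orP[]/eqP->; split=> //; case=> h1 h2.
  by have := h2 erefl.
by have := h1 erefl.
Qed.

Variables p q : nat.
Hypothesis sp : is_struct_index p.
Hypothesis sq : is_struct_index q.

Lemma emb_atP f : (forall x y i s, emb_at (eval_value g) p q f x y i s) <->
  embedding f (struct_of p) (struct_of q).
Proof.
have bp x : isbit (eval_value g 0 p x) by apply/isbitP.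
have bq x : isbit (eval_value g 0 q x) by apply/isbitP.
split=> [E|[inj pres] x y i s].
  split=> [x y h|i s].
    by have /andP[/orP[]] := E x y 0 0; [rewrite h eqxx | move/eqP].
  rewrite !struct_ofE -lmapE; apply/bit_eq => //.
  by have /andP[] := E 0 0 i (lc s).
apply/andP; split; first by case: (eqVneq x y) => [|xy]; rewrite ?orbT // inj_eq // xy.
apply/bit_eq => //; rewrite -(CodeSeq.decodeK s) lmapE -!struct_ofE.
exact: pres.
Qed.

Lemma bad_atP e : (exists x y i s, bad_at (eval_value g) p q e x y i s) <->
  ~ exists2 f, (forall x, phi halting_oracle e x (f x)) & embedding f (struct_of p) (struct_of q).
Proof.
split=> [[x [y [i [s B]]]] [f Ef emb]|no].
  have Df z : eval_value g 1 e z = (f z).+1 by apply/(eval_valueP Bg 1).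
  have /emb_atP/(_ x y i s)/andP[h1 h2] := emb.
  move: B; rewrite /bad_at !Df eqSS /=; case/orP => [/andP[xy fxy]|].
    by move: h1; rewrite fxy (negPf xy).
  by rewrite (_ : (fun z => _) = f) ?h2 //; apply: functional_extensionality => z; rewrite Df.
apply: NNPP => nob; case: no; exists (fun z => (eval_value g 1 e z).-1).
  move=> x; apply/(eval_valueP Bg 1); rewrite prednK // lt0n; apply/negP => /eqP h.
  by case: nob; exists x, 0, 0, 0; rewrite /bad_at h eqxx.
apply/emb_atP => x y i s; apply: NNPP => /negP h; apply: (nob).
exists x, y, i, s; move: h; rewrite /emb_at /bad_at negb_and negb_or negbK.
case/orP => [/andP[e1 ->]|->]; last by rewrite orbT.
case E1: (eval_value g 1 e x) => [|u] //=; case E2: (eval_value g 1 e y) => [|v].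
  exfalso; apply: nob; exists y, 0, 0, 0; by rewrite /bad_at E2.
move: e1; rewrite E1 E2 /= => /eqP ->; by rewrite eqxx.
Qed.

End Satisfaction.

(** The fuels in [halt_table] may differ between worlds, but the values are fixed by [phi]. Hence
    witnesses found in one world can be stored in another. *)
Lemma eval_value_unique g g' : eval_world g -> eval_world g' -> eval_value g = eval_value g'.
Proof.
move=> Bg Bg'; apply: functional_extensionality => o; apply: functional_extensionality => e.
apply: functional_extensionality => x.
case E: (eval_value g o e x) => [|v].
  case E': (eval_value g' o e x) => [|v] //.
  by move/(eval_valueP Bg')/(eval_valueP Bg): E'; rewrite E.
by move/(eval_valueP Bg)/(eval_valueP Bg'): E.
Qed.

Definition aux_table g j y : nat := g (npair j.+2 y).

(* Table 0 holds a flag (0: [n] is not an index of a structure, as witnessed by entry 1),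
   an index [a] and a bit; tables 1 and 2 are embeddings of [a] in [n] and back; tables
   3 to 6 refute every 0'-computable embedding in the direction given by the bit. *)
Definition noncat_matrix (g : nat -> nat) n t1 t2 t3 t4 : bool :=
  eval_world_at g t1 t2 t3 t4 &&
  if aux_table g 0 0 == 0 then ~~ isbit (eval_value g 0 n (aux_table g 0 1)) else
  [&& isbit (eval_value g 0 n t1), isbit (eval_value g 0 (aux_table g 0 2) t1),
      emb_at (eval_value g) (aux_table g 0 2) n (fun z => aux_table g 1 z) t1 t2 t3 t4,
      emb_at (eval_value g) n (aux_table g 0 2) (fun z => aux_table g 2 z) t1 t2 t3 t4 &
      bad_at (eval_value g) (if aux_table g 0 3 == 0 then aux_table g 0 2 else n)
        (if aux_table g 0 3 == 0 then n else aux_table g 0 2)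
        t1 (aux_table g 3 t1) (aux_table g 4 t1) (aux_table g 5 t1) (aux_table g 6 t1)].

Lemma frec_aux_table j F : frec F -> frec (fun g x => aux_table g j (F g x)).
Proof. by move=> CF; rewrite /aux_table; frec_tac. Qed.

Ltac frec_world_step := first [frec_step | match goal with
  | |- frec (fun g x => aux_table g ?j (@?F g x)) => apply: (@frec_aux_table j F)
  | |- frec (fun g x => eval_value g (@?a g x) (@?b g x) (@?c g x)) =>
     apply: (@frec_eval_value a b c)
  | |- frec (fun g x => lmap (fun i => @?f g i x) (@?l g x)) => apply: (@frec_lmap f l)
  | |- frec (fun g x => nat_of_bool (eval_world_at g (@?a g x) (@?b g x) (@?c g x) (@?d g x))) =>
     apply: (@frec_eval_world_at a b c d)
 end; cbv beta].
Ltac frec_world_tac := repeat frec_world_step.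

Lemma frec_noncat_matrix : frec (fun g z =>
  noncat_matrix g (nfst z) (nfst (nsnd z)) (nfst (nsnd (nsnd z)))
  (nfst (nsnd (nsnd (nsnd z)))) (nsnd (nsnd (nsnd (nsnd z))))).
Proof. by rewrite /noncat_matrix /emb_at /bad_at /isbit /atom; frec_world_tac. Qed.

Lemma not_index_setP n : ~ index_set_0jump_cbe n <->
  exists g, forall t1 t2 t3 t4, noncat_matrix g n t1 t2 t3 t4.
Proof.
split.
  move=> nX.
  have [sn|nsn] := classic (is_struct_index n); last first.
    have [x0 Hx0] : exists x, ~ exists b, b <= 1 /\ phi0 n x b by apply: not_all_ex_not.
    pose u j y := if j == 0 then if y == 1 then x0 else 0 else 0.
    have [g Bg Hu] := eval_world_exists u; exists g => t1 t2 t3 t4.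
    rewrite /noncat_matrix Bg /aux_table !Hu /=; by apply/negP => /(isbitP Bg).
  have [a na] : exists a, ~ (is_struct_index a -> biemb (struct_of a) (struct_of n) ->
     exists f g, zero_jump_computable f /\ zero_jump_computable g /\
      embedding f (struct_of a) (struct_of n) /\ embedding g (struct_of n) (struct_of a)).
    by apply: not_all_ex_not => H; apply: nX.
  have [sa {}na] := imply_to_and _ _ na.
  have [[[F0 HF] [G0 HG]] {}na] := imply_to_and _ _ na.
  (* The witnesses against candidate embeddings are found in this world, before the world [g] that
     stores them is built. *)
  have [g0 Bg0 _] := eval_world_exists (fun _ _ => 0).
  (* If some 0'-computable embedding of [a] in [n] exists, none exists backwards; hence one fixed
     direction fails for all [e]. *)
  have [bit Hbit] : exists bit, forall e, exists x y i s, bad_at (eval_value g0)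
      (if bit == 0 then a else n) (if bit == 0 then n else a) e x y i s.
    have [[f Cf Ef]|nf] := classic (exists2 f, zero_jump_computable f &
                                      embedding f (struct_of a) (struct_of n)).
      exists 1 => e; apply/bad_atP => // -[f' Cf' Ef']; case: na.
      by exists f, f'; split=> //; split=> //; exists e.
    exists 0 => e; apply/bad_atP => // -[f' Cf' Ef']; case: nf.
    by exists f' => //; exists e.
  have [W HW] : exists W : nat -> nat * nat * nat * nat, forall e, bad_at (eval_value g0)
      (if bit == 0 then a else n) (if bit == 0 then n else a) e
      (W e).1.1.1 (W e).1.1.2 (W e).1.2 (W e).2.
    apply: (choice (fun e w => bad_at (eval_value g0)
      (if bit == 0 then a else n) (if bit == 0 then n else a) e w.1.1.1 w.1.1.2 w.1.2 w.2)) => e.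
    by have [x [y [i [s h]]]] := Hbit e; exists (x, y, i, s).
  pose u j y := match j with
    | 0 => match y with 0 => 1 | 1 => 0 | 2 => a | _ => bit end
    | 1 => F0 y | 2 => G0 y | 3 => (W y).1.1.1 | 4 => (W y).1.1.2 | 5 => (W y).1.2 | _ => (W y).2
    end.
  have [g Bg Hu] := eval_world_exists u; exists g => t1 t2 t3 t4.
  have TE j y : aux_table g j y = u j y by apply: Hu.
  rewrite /noncat_matrix Bg !TE /= -(eval_value_unique Bg0 Bg) HW andbT (eval_value_unique Bg0 Bg).
  apply/and4P; split; try by apply/isbitP.
    rewrite (_ : (fun z => _) = F0); first exact: (proj2 (emb_atP Bg sa sn F0) HF).
    by apply: functional_extensionality => z; rewrite TE.
  rewrite (_ : (fun z => _) = G0); first exact: (proj2 (emb_atP Bg sn sa G0) HG).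
  by apply: functional_extensionality => z; rewrite TE.
case=> g B [sn cat].
have Bg : eval_world g by move=> t1 t2 t3 t4; have /andP[] := B t1 t2 t3 t4.
have {B} B t1 t2 t3 t4 := proj2 (andP (B t1 t2 t3 t4)).
case c0: (aux_table g 0 0 == 0) B => B.
  by have /negP := B 0 0 0 0; apply; exact: (proj2 (isbitP Bg _ _) (sn _)).
have sa : is_struct_index (aux_table g 0 2).
  by move=> x; apply/(isbitP Bg); have /and5P[] := B x 0 0 0.
have eF : embedding (fun z => aux_table g 1 z) (struct_of (aux_table g 0 2)) (struct_of n).
  by apply/(emb_atP Bg) => // t1 t2 t3 t4; have /and5P[] := B t1 t2 t3 t4.
have eG : embedding (fun z => aux_table g 2 z) (struct_of n) (struct_of (aux_table g 0 2)).
  by apply/(emb_atP Bg) => // t1 t2 t3 t4; have /and5P[] := B t1 t2 t3 t4.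
have [|f1 [f2 [[e1 C1] [[e2 C2] [E1 E2]]]]] := cat _ sa.
  by split; [exists (fun z => aux_table g 1 z) | exists (fun z => aux_table g 2 z)].
have B5 e := and5P (B e 0 0 0).
case bE: (aux_table g 0 3 == 0) B5 => B5.
  have [_ _ _ _ b] := B5 e1.
  have /(bad_atP Bg sa sn) : exists x y i s, bad_at (eval_value g) (aux_table g 0 2) n e1 x y i s.
    by do 4 eexists; apply: b.
  by apply; exists f1.
have [_ _ _ _ b] := B5 e2.
have /(bad_atP Bg sn sa) : exists x y i s, bad_at (eval_value g) n (aux_table g 0 2) e2 x y i s.
  by do 4 eexists; apply: b.
by apply; exists f2.
Qed.

Lemma index_set_Pi11 : Pi11 index_set_0jump_cbe.
Proof.
apply: (Pi11_of_functional frec_noncat_matrix) => n.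
rewrite not_index_setP; split=> -[g Hg]; exists g.
  move=> x; rewrite nfst_npair nsnd_npair.
  by rewrite Hg.
move=> t1 t2 t3 t4; have := Hg (npair t1 (npair t2 (npair t3 t4))).
by rewrite !(nfst_npair, nsnd_npair); case: noncat_matrix.
Qed.

(** * The structure of a tree *)

(** Answering every query by 0 simulates the empty oracle under any oracle. *)
Fixpoint drop_oracle (c : code) : code :=
  match c with
  | COracle => CZero
  | CPair f g => CPair (drop_oracle f) (drop_oracle g)
  | CComp f g => CComp (drop_oracle f) (drop_oracle g)
  | CRec f g => CRec (drop_oracle f) (drop_oracle g)
  | CMu f => CMu (drop_oracle f)
  | c => c
  end.

Lemma eval_drop_oracle A k c x : eval A k (drop_oracle c) x = eval empty_oracle k c x.
Proof.
elim: k c x => // k IH c x; rewrite !evalS; case: c => //= [f g|f g|f g|f].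
- by rewrite !IH.
- by rewrite IH; case: (eval _ k g x) => //= y; rewrite IH.
- by elim: (nfst x) => /= [|n ->]; rewrite ?IH //; case: (rec_loop _ _ _ n) => // v; rewrite IH.
- move: 0 {2 4}k => i b; elim: b i => //= b IHb i.
  by rewrite IH; case: eval => // -[].
Qed.

Lemma orec0_orec A f : orec0 f -> orec A f.
Proof.
case=> c Ec; exists (drop_oracle c) => x.
by have [k Ek] := Ec x; exists k; rewrite eval_drop_oracle.
Qed.

(** The search for a witness gets an index that depends on [z] and ignores its own input, so it
    halts on that index exactly when a witness exists. *)
Lemma sigma1_halting p : orec2 empty_oracle p ->
  exists2 h, orec0 h & forall z, halting (h z) <-> exists i, p i z = 0.
Proof.
move=> Cp.
have [c Ec] : orec0 (fun w => p (nfst w) (nfst (nsnd w))) by orec_tac.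
have Ep i z x : ev empty_oracle c (npair i (npair z x)) (p i z).
  by have := Ec (npair i (npair z x)); rewrite !(nfst_npair, nsnd_npair).
exists (smn (CMu c)); first exact: orec_smn.
move=> z; split=> [[y /phi_smn]|ex].
  set x := npair _ _; case=> -[|k] //; rewrite evalS.
  suff L b i : mu_loop (eval empty_oracle k c) x i b = Some y -> exists i, p i z = 0 by apply: L.
  elim: b i => //= b IHb i; case E: eval => [[|v]|] //; last exact: IHb.
  by move=> _; exists i; apply: ev_inj (Ep i z (smn (CMu c) z)) _; exists k.
have ex' : exists i, p i z == 0 by case: ex => i /eqP; exists i.
case: (ex_minnP ex') => m /eqP pm min; exists m; apply/phi_smn.
apply: ev_mu => [i im|]; last by rewrite -pm; apply: Ep.
have: p i z != 0 by apply/negP => /min; rewrite leqNgt im.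
by have := Ep i z (smn (CMu c) z); case: (p i z) => // v; exists v.
Qed.

(* Symbol 0 is the equivalence relation with classes [cl], symbol [l.+1] the label [l]. *)
Definition lstruct (cl lb : nat -> nat) : structure := fun i s =>
  match s with
  | [:: x] => i = (lb x).+1
  | [:: x; y] => i = 0 /\ cl x = cl y
  | _ => False
  end.

Definition lstruct_char (cl lb : nat -> nat) z : nat :=
  if lsize (lnth z 1) == 2 then
    nat_of_bool ((lnth z 0 == 0) && (cl (lnth (lnth z 1) 0) == cl (lnth (lnth z 1) 1)))
  else nat_of_bool ((lsize (lnth z 1) == 1) && (lnth z 0 == (lb (lnth (lnth z 1) 0)).+1)).

Lemma lstruct_charP cl lb i s : lstruct_char cl lb (pickle (i, s)) = 1 <-> lstruct cl lb i s.
Proof.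
rewrite pickle_pairE /lstruct_char !lnth_lc /= lsize_lc ?lnth_lc.
case: s => [|x [|y [|z s]]] //=.
  by case: eqP => [->|].
by split=> [|[-> ->]]; [case: eqP => [->|] //; case: eqP => [->|] // | rewrite !eqxx].
Qed.

Lemma lstruct_char_le1 cl lb z : lstruct_char cl lb z <= 1.
Proof. by rewrite /lstruct_char; case: ifP => _; case: (_ && _). Qed.

Lemma lstruct_embedding f cl lb cl' lb' :
  embedding f (lstruct cl lb) (lstruct cl' lb') <->
  [/\ injective f, forall x y, cl x = cl y <-> cl' (f x) = cl' (f y) & forall x, lb' (f x) = lb x].
Proof.
split=> [[inj pres]|[inj Hc Hl]].
  split=> // [x y|x].
    by have /= [h1 h2] := pres 0 [:: x; y]; split=> e; [case: h1 | case: h2].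
  by have /= [h1 _] := pres (lb x).+1 [:: x]; case: (h1 erefl).
split=> // i [|x [|y [|z s]]] //=; first by rewrite Hl.
by split=> -[-> e]; split=> //; apply/Hc.
Qed.

Lemma structure_ext (A B : structure) : (forall i s, A i s <-> B i s) ->
  forall f C, (embedding f A C <-> embedding f B C) /\ (embedding f C A <-> embedding f C B).
Proof.
move=> E f C; split; split=> -[inj H]; split=> // i s; rewrite ?E // ?H //.
by rewrite -E.
Qed.

Section Tree.
Variable rho : nat -> nat.

(* The element [npair (lc s) i] with [i <= size s] lies in the class of the node [s] and is
   labelled by the initial segment of [s] of length [i].  All other numbers are padding:
   each forms a class of its own with a private label. *)
Definition in_treeb l := bforall (lsize l).+1 (fun m => rho (ltake l m)).
Definition legit x := (nsnd x <= lsize (nfst x)) && (in_treeb (nfst x) != 0).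
Definition cls x := if legit x then npair 0 (nfst x) else npair 1 x.
Definition lab x := if legit x then npair 0 (ltake (nfst x) (nsnd x)) else npair 1 x.

Definition elt (s : seq nat) i := npair (lc s) i.
Definition in_tree s := forall m, m <= size s -> rho (lc (take m s)) != 0.

Lemma lc_inj s t : lc s = lc t -> s = t.
Proof. exact: (can_inj CodeSeq.codeK). Qed.

Lemma elt_inj s i t j : elt s i = elt t j -> s = t /\ i = j.
Proof. by case/npair_inj => /lc_inj -> ->. Qed.

Lemma eltE x : x = elt (ld (nfst x)) (nsnd x).
Proof. by rewrite /elt CodeSeq.decodeK npair_nfst_nsnd. Qed.

Lemma legitP s i : legit (elt s i) <-> in_tree s /\ i <= size s.
Proof.
rewrite /legit /elt nfst_npair nsnd_npair lsize_lc; split.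
  case/andP=> is_ /bforallP H; split=> // m ms.
  by have := H m; rewrite lsize_lc ltnS ltakeE //; apply.
case=> T ->; apply/bforallP => k; rewrite lsize_lc ltnS => ks.
by rewrite ltakeE //; apply: T.
Qed.

Lemma lab_elt s i : in_tree s -> i <= size s -> lab (elt s i) = npair 0 (lc (take i s)).
Proof.
move=> Ts is_; rewrite /lab (_ : legit _); last exact/legitP.
by rewrite nfst_npair nsnd_npair ltakeE.
Qed.

Lemma cls_elt s i : in_tree s -> i <= size s -> cls (elt s i) = npair 0 (lc s).
Proof.
move=> Ts is_; rewrite /cls (_ : legit _); last exact/legitP.
by rewrite nfst_npair.
Qed.

Lemma legit_elt x : legit x -> exists s i, [/\ x = elt s i, in_tree s & i <= size s].
Proof. by rewrite {1}(eltE x) => /legitP[? ?]; do 2 eexists; split; first exact: eltE. Qed.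

(** * Self-embeddings extend nodes and generate paths *)

Section SelfEmbedding.
Variable h : nat -> nat.
Hypothesis h_emb : embedding h (lstruct cls lab) (lstruct cls lab).

Let h_inj : injective h. Proof. by case: h_emb. Qed.
Let h_cls x y : cls x = cls y -> cls (h x) = cls (h y).
Proof. by case/lstruct_embedding: h_emb => _ H _ /H. Qed.
Let h_lab x : lab (h x) = lab x.
Proof. by case/lstruct_embedding: h_emb. Qed.

(* A self-embedding maps the class of [s] into the class of [node_map s]. *)
Definition node_map (s : seq nat) := ld (nfst (h (elt s 0))).

Lemma self_embedding_junk x : legit x = false -> h x = x.
Proof.
move=> lx; have := h_lab x; rewrite /lab lx.
by case: ifP => _ /npair_inj[].
Qed.

(** The label of an element of a node is an initial segment whose length is the index, so preserving
    it fixes both; the private labels of padding rule out padding as a value. *)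
Lemma self_embedding_legit s i : in_tree s -> i <= size s ->
  exists t, [/\ h (elt s i) = elt t i, in_tree t, i <= size t & take i t = take i s].
Proof.
move=> Ts is_; have := h_lab (elt s i); rewrite lab_elt //.
case l: (legit (h (elt s i))); last by rewrite /lab l => /npair_inj[].
have [t [j [E Tt jt]]] := legit_elt l.
rewrite E lab_elt // => /npair_inj[_ /lc_inj e].
have ij : j = i by have := congr1 size e; rewrite !size_takel.
by rewrite ij in e jt *; exists t.
Qed.

(** Preserving the equivalence sends one class into a single class, so the node of the image does
    not depend on [i]. *)
Lemma self_embedding_elt s i : in_tree s -> i <= size s ->
  [/\ h (elt s i) = elt (node_map s) i, in_tree (node_map s), i <= size (node_map s) &
      take i (node_map s) = take i s].
Proof.
move=> Ts is_; have [t [E Tt it e]] := self_embedding_legit Ts is_.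
have [t0 [E0 Tt0 it0 _]] := self_embedding_legit Ts (leq0n _).
have : cls (elt s i) = cls (elt s 0) by rewrite !cls_elt.
move/h_cls; rewrite E E0 !cls_elt // => /npair_inj[_ /lc_inj tt0].
by rewrite (_ : node_map s = t) // /node_map E0 nfst_npair CodeSeq.codeK.
Qed.

Lemma in_tree_node_map s : in_tree s -> in_tree (node_map s).
Proof. by move=> Ts; have [] := self_embedding_elt Ts (leq0n _). Qed.

(** The element with index [size s] has all of [s] as its label, and its image keeps that label. *)
Lemma node_map_prefix s :
  in_tree s -> size s <= size (node_map s) /\ take (size s) (node_map s) = s.
Proof. by move=> Ts; have [_ _ ? ->] := self_embedding_elt Ts (leqnn _); rewrite take_size. Qed.

Lemma node_map_inj s t : in_tree s -> in_tree t -> node_map s = node_map t -> s = t.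
Proof.
move=> Ts Tt e; have [Es _ _ _] := self_embedding_elt Ts (leq0n _).
have [Et _ _ _] := self_embedding_elt Tt (leq0n _).
by have /h_inj/elt_inj[] : h (elt s 0) = h (elt t 0) by rewrite Es Et e.
Qed.

Lemma self_embedding_id : (forall s, in_tree s -> node_map s = s) -> forall x, h x = x.
Proof.
move=> HE x; case l: (legit x); last exact: self_embedding_junk.
have [s [i [-> Ts is_]]] := legit_elt l.
by have [-> _ _ _] := self_embedding_elt Ts is_; rewrite HE.
Qed.

(** The iterates of a moved node form an increasing chain; after [i.+1] steps the length exceeds
    [i], so entry [i] can be read off. The form through [h] shows that the path is computable from
    [h]. *)
Definition iter_path l i := lnth (iter i.+1 (fun l => nfst (h (npair l 0))) l) i.

Lemma iter_pathP s : in_tree s -> node_map s <> s ->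
  forall m, rho (init_code (iter_path (lc s)) m) != 0.
Proof.
move=> Ts Hs m.
have T k : in_tree (iter k node_map s) by elim: k => //= k; apply: in_tree_node_map.
have E k : iter k (fun l => nfst (h (npair l 0))) (lc s) = lc (iter k node_map s).
  by elim: k => //= k ->; rewrite /node_map CodeSeq.decodeK.
(* By injectivity of [node_map], a node that moves once moves at every later iteration. *)
have ne k : iter k.+1 node_map s <> iter k node_map s.
  by elim: k => // k IH /= /(node_map_inj (T k.+1) (T k)).
have sz k : k <= size (iter k node_map s).
  elim: k => // k IH; apply: leq_ltn_trans IH _.
  have [le tk] := node_map_prefix (T k); rewrite ltn_neqAle le andbT; apply/negP => /eqP e.
  by case: (ne k); rewrite -[RHS]tk e take_size.
have pf j k : take (size (iter k node_map s)) (iter (j + k) node_map s) = iter k node_map s.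
  elim: j => [|j IH]; first by rewrite take_size.
  have [le tk] := node_map_prefix (T (j + k)).
  have le2 : size (iter k node_map s) <= size (iter (j + k) node_map s).
    by rewrite -{1}IH size_take; case: ltnP => // /ltnW.
  by rewrite -[in RHS]IH -[in RHS]tk -take_min (minn_idPl le2).
rewrite (_ : init_code _ m = lc (take m (iter m node_map s))); first exact: T.
congr lc; apply: (@eq_from_nth _ 0); rewrite size_map size_iota ?size_takel //.
move=> i im; rewrite (nth_map 0) ?size_iota // nth_iota // add0n nth_take //.
rewrite /iter_path E lnth_lc -(pf (m - i.+1) i.+1) subnK // nth_take //.
Qed.

End SelfEmbedding.

(** * Shifting the structure along an infinite path *)

Section Path.
Variable g : nat -> nat.
Hypothesis gP : forall m, rho (init_code g m) != 0.

Let gs m := [seq g i | i <- iota 0 m].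

Lemma size_gs m : size (gs m) = m.
Proof. by rewrite size_map size_iota. Qed.

Lemma take_gs m k : m <= k -> take m (gs k) = gs m.
Proof. by move=> mk; rewrite /gs -map_take take_iota (minn_idPl mk). Qed.

Lemma in_tree_gs k : in_tree (gs k).
Proof. by move=> m; rewrite size_gs => mk; rewrite take_gs //; apply: gP. Qed.

Definition on_path x := legit x && (nfst x == init_code g (lsize (nfst x))).
(** Each class on the path goes to the class of the next node, which contains all its labels;
    everything else stays fixed. *)
Definition path_shift x :=
  if on_path x then npair (init_code g (lsize (nfst x)).+1) (nsnd x) else x.

Lemma on_pathP x : on_path x -> exists k i, [/\ x = elt (gs k) i & i <= k].
Proof.
case/andP=> /legit_elt[s [i [-> Ts is_]]].
rewrite nfst_npair lsize_lc => /eqP /lc_inj es.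
by exists (size s), i; rewrite -/(gs _) in es; rewrite -es.
Qed.

Lemma on_path_gs k i : i <= k -> on_path (elt (gs k) i).
Proof.
move=> ik; apply/andP; split; first by apply/legitP; split; [apply: in_tree_gs | rewrite size_gs].
by rewrite nfst_npair lsize_lc size_gs.
Qed.

Lemma path_shift_gs k i : i <= k -> path_shift (elt (gs k) i) = elt (gs k.+1) i.
Proof.
by move=> ik; rewrite /path_shift on_path_gs // nfst_npair nsnd_npair lsize_lc size_gs.
Qed.

Lemma gs_inj k k' : gs k = gs k' -> k = k'.
Proof. by move/(congr1 size); rewrite !size_gs. Qed.

Lemma cls_on_path k i y : i <= k -> cls (elt (gs k) i) = cls y ->
  exists2 j, y = elt (gs k) j & j <= k.
Proof.
move=> ik; rewrite cls_elt ?size_gs //; last exact: in_tree_gs.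
rewrite /cls; case: ifP => [/legit_elt[s [j [-> Ts js]]]|_] /npair_inj[] // _.
by rewrite nfst_npair => /lc_inj e; exists j; rewrite ?e // -(size_gs k) e.
Qed.

(** A class on the path consists of on-path elements only ([cls_on_path]), so moved and fixed
    elements never become equivalent. *)
Lemma path_shift_embedding : embedding path_shift (lstruct cls lab) (lstruct cls lab).
Proof.
have no x k i : on_path x = false -> i <= k -> x <> elt (gs k) i.
  by move=> nx ik e; move: nx; rewrite e on_path_gs.
have cE k i : i <= k -> cls (elt (gs k) i) = npair 0 (lc (gs k)).
  by move=> ik; rewrite cls_elt ?size_gs //; apply: in_tree_gs.
apply/lstruct_embedding; split.
- move=> x y; case ox: (on_path x); case oy: (on_path y).
  + have [k [i [-> ik]]] := on_pathP ox; have [k' [i' [-> ik']]] := on_pathP oy.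
    by rewrite !path_shift_gs // => /elt_inj[/gs_inj[->] ->].
  + have [k [i [-> ik]]] := on_pathP ox; rewrite path_shift_gs // /path_shift oy => /esym.
    by move/no; case=> //; apply: leqW.
  + have [k [i [-> ik]]] := on_pathP oy; rewrite path_shift_gs // /path_shift ox.
    by move/no; case=> //; apply: leqW.
  + by rewrite /path_shift ox oy.
- move=> x y; case ox: (on_path x); case oy: (on_path y).
  + have [k [i [-> ik]]] := on_pathP ox; have [k' [i' [-> ik']]] := on_pathP oy.
    rewrite !path_shift_gs // !cE //; try exact: leqW.
    by split=> /npair_inj[_ /lc_inj/gs_inj] => [->|[->]].
  + have [k [i [-> ik]]] := on_pathP ox; rewrite path_shift_gs // [path_shift y]/path_shift oy.
    by split=> [/(cls_on_path ik)|/(cls_on_path (leqW ik))][j e jk]; case: (no _ _ _ oy jk).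
  + have [k [i [-> ik]]] := on_pathP oy; rewrite path_shift_gs // [path_shift x]/path_shift ox.
    by split=> /esym; [move/(cls_on_path ik) | move/(cls_on_path (leqW ik))];
      case=> j e jk; case: (no _ _ _ ox jk).
  + by rewrite /path_shift ox oy.
- move=> x; case ox: (on_path x); last by rewrite /path_shift ox.
  have [k [i [-> ik]]] := on_pathP ox; rewrite path_shift_gs //.
  rewrite !lab_elt ?size_gs ?leqW //; try exact: in_tree_gs.
  by rewrite !take_gs // leqW.
Qed.

(** 0 is the only element of the root class, and the shift vacates that class since every path
    starts at the root. *)
Lemma path_shift_neq0 x : path_shift x <> 0.
Proof.
have e0 : 0 = elt (gs 0) 0 by [].
case ox: (on_path x).
  have [k [i [-> ik]]] := on_pathP ox; rewrite path_shift_gs // e0.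
  by case/elt_inj => /gs_inj.
by rewrite /path_shift ox => e; move: ox; rewrite e e0 on_path_gs.
Qed.

Lemma path_shift_embedding_succ :
  embedding (fun x => (path_shift x).-1) (lstruct cls lab)
    (lstruct (fun x => cls x.+1) (fun x => lab x.+1)).
Proof.
have P x : (path_shift x).-1.+1 = path_shift x by have := @path_shift_neq0 x; case: path_shift.
have /lstruct_embedding[inj Hc Hl] := path_shift_embedding.
apply/lstruct_embedding; split.
- by move=> x y e; apply: inj; rewrite -P e P.
- by move=> x y; rewrite !P.
- by move=> x; rewrite P.
Qed.

End Path.

(* The root class is the single element [elt [::] 0 = 0], so removing it is a shift by 1. *)
Lemma succ_embedding :
  embedding S (lstruct (fun x => cls x.+1) (fun x => lab x.+1)) (lstruct cls lab).
Proof. by apply/lstruct_embedding; split=> // x y []. Qed.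

End Tree.

(** * Well-founded trees *)

Lemma embedding_comp f g A B C :
  embedding f A B -> embedding g B C -> embedding (fun x => g (f x)) A C.
Proof.
case=> injf Hf [injg Hg]; split=> [x y /injg/injf //|i s].
by rewrite Hf Hg -map_comp.
Qed.

Lemma struct_index_chi a : is_struct_index a ->
  exists2 chi : nat -> nat, orec0 chi & forall i s, struct_of a i s <-> chi (pickle (i, s)) = 1.
Proof.
move=> sa; have [chi Hchi] : exists chi : nat -> nat, forall x, phi0 a x (chi x).
  by apply: (choice (fun x b => phi0 a x b)) => x; have [b []] := sa x; exists b.
exists chi; first by apply/orec_computable; exists a.
move=> i s; split=> [h|e]; last by rewrite /struct_of -e; apply: Hchi.
have [k [c [dec E]]] := Hchi (pickle (i, s)); case: h => k' [c' []]; rewrite dec => -[<-] E'.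
exact: ev_inj (ex_intro _ k E) (ex_intro _ k' E').
Qed.

Section WellFounded.
Variable rho : nat -> nat.
Hypothesis wf : forall g, ~ forall m, rho (init_code g m) != 0.
Local Notation cls := (cls rho).
Local Notation lab := (lab rho).
Variables (a : nat) (f g : nat -> nat).
Hypothesis sa : is_struct_index a.
Hypothesis f_emb : embedding f (struct_of a) (lstruct cls lab).
Hypothesis g_emb : embedding g (lstruct cls lab) (struct_of a).

(** The composite is a self-embedding, and a node moved by it would yield a path. *)
Lemma wf_embeddingK x : f (g x) = x.
Proof.
have h_emb := embedding_comp g_emb f_emb.
apply: (self_embedding_id h_emb) => s Ts; apply: NNPP => Hs.
exact: wf (iter_pathP h_emb Ts Hs).
Qed.

Let f_inj : injective f. Proof. by case: f_emb. Qed.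

(** Each element has exactly one label, so a search through the computable diagram of [a] finds it
    without an oracle. *)
Lemma orec_lab_f : orec0 (fun x => lab (f x)).
Proof.
have [chi Cchi Hchi] := struct_index_chi sa.
have E l x : chi (atom l.+1 (lcons x 0)) = 1 <-> lab (f x) = l.
  have -> : lcons x 0 = lc [:: x] by rewrite lc_cons.
  rewrite atomE -Hchi (proj2 f_emb) /=; split=> [[]|->] //.
apply: (@orec_mu _ (fun l x => chi (atom l.+1 (lcons x 0)) != 1)).
- by rewrite /orec2 /atom; orec_tac.
- by move=> x; rewrite (proj2 (E _ _) erefl).
- by move=> x i ix; rewrite eqb0 negbK; apply/negP => /eqP/E e; rewrite e ltnn in ix.
Qed.

Lemma orec_cls_f : orec0 (fun z => cls (f (nfst z)) == cls (f (nsnd z))).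
Proof.
have [chi Cchi Hchi] := struct_index_chi sa.
have C : orec0 (fun z => chi (atom 0 (lcons (nfst z) (lcons (nsnd z) 0))) == 1).
  by rewrite /atom; orec_tac.
apply: orec_ext C => z; congr nat_of_bool.
have -> : lcons (nfst z) (lcons (nsnd z) 0) = lc [:: nfst z; nsnd z] by rewrite !lc_cons.
rewrite atomE; apply/eqP/eqP => [/Hchi/(proj2 f_emb)[] //|h].
by apply/Hchi/(proj2 f_emb).
Qed.

Definition len x := lsize (nsnd (lab (f x))).
(* The elements that are not [longer] are those whose label is the whole node. *)
Definition longer z := exists z', cls (f z) = cls (f z') /\ len z < len z'.

Lemma len_elt x s i : f x = elt s i -> in_tree rho s -> i <= size s -> len x = i.
Proof. by move=> E Ts is_; rewrite /len E lab_elt // nsnd_npair lsize_lc size_takel. Qed.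

Lemma longer_elt x s i : f x = elt s i -> in_tree rho s -> i <= size s -> longer x <-> i < size s.
Proof.
move=> E Ts is_; split=> [[z []]|lt].
  rewrite (len_elt E) // E cls_elt // {1}/cls; case: ifP => [|_ /npair_inj[] //].
  case/legit_elt=> t [j [Ez Tt jt]]; rewrite Ez nfst_npair => /npair_inj[_ /lc_inj st].
  by rewrite (len_elt Ez) // st => /leq_trans; apply.
exists (g (elt s (size s))).
have Ez := wf_embeddingK (elt s (size s)).
by rewrite (len_elt E) // (len_elt Ez) // E Ez !cls_elt.
Qed.

(** A longer label in the same class is a Sigma^0_1 event, so one query to the halting set decides
    it. *)
Lemma longer_dec : exists2 lg : nat -> bool, orec halting_oracle (fun x => lg x) &
  forall z, lg z <-> longer z.
Proof.
have C1 := orec_lab_f; have C2 := orec_cls_f.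
have Clen : orec0 len.
  by rewrite /len; apply: (orec_app1 (orec_lsize _)); apply: (orec_app1 (orec_snd _)).
have [h Ch Hh] : exists2 h, orec0 h & forall z, halting (h z) <->
    exists i, nat_of_bool (~~ ((cls (f z) == cls (f i)) && (len z < len i))) = 0.
  apply: (@sigma1_halting (fun i z => ~~ ((cls (f z) == cls (f i)) && (len z < len i)))).
  have C3 : orec0 (fun w => cls (f (nsnd w)) == cls (f (nfst w))).
    apply: orec_ext (orec_app1 C2 (orec_pair (orec_snd _) (orec_fst _))) => w.
    by rewrite nfst_npair nsnd_npair.
  rewrite /orec2; apply: orec_negb; apply: orec_andb => //; orec_tac.
exists (fun z => halting_oracle (h z)).
  exact: orec_app1 (orec_oracle _) (orec0_orec _ Ch).
move=> z; rewrite /halting_oracle.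
have -> : longer z <-> halting (h z).
  rewrite Hh; split=> -[i].
    by case=> /eqP e l; exists i; rewrite e l.
  by case E: (_ && _) => // _; exists i; case/andP: E => /eqP.
by case: excluded_middle_informative.
Qed.

Lemma wf_orec_embedding : orec halting_oracle f.
Proof.
have [lg Clg Hlg] := longer_dec.
(* A top of the class of [x] is sought, labelled by the whole node. In the class of a node, [g]
   supplies it as a preimage under [f]; an element mapped to padding is its own top. *)
have ex x : exists z, (cls (f x) == cls (f z)) && ~~ lg z.
  case l: (legit rho (f x)).
    have [s [i [E Ts is_]]] := legit_elt l; exists (g (elt s (size s))).
    have Ez := wf_embeddingK (elt s (size s)).
    rewrite E Ez !cls_elt // eqxx /=; apply/negP => /Hlg/(longer_elt Ez) h.
    by have := h Ts (leqnn _); rewrite ltnn.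
  exists x; rewrite eqxx; apply/negP => /Hlg[z []].
  rewrite {1}/cls l {1}/cls; case: ifP => [_ /npair_inj[] //|_ /npair_inj[_ /f_inj ->]].
  by rewrite ltnn.
pose top x := ex_minn (ex x).
have C1 : orec halting_oracle (fun x => lab (f x)) := orec0_orec _ orec_lab_f.
have Ctop : orec halting_oracle top.
  apply: (@orec_mu _ (fun z x => ~~ ((cls (f x) == cls (f z)) && ~~ lg z))).
  - have C2 := orec0_orec halting_oracle orec_cls_f.
    have C3 : orec halting_oracle (fun w => cls (f (nsnd w)) == cls (f (nfst w))).
      apply: orec_ext (orec_app1 C2 (orec_pair (orec_snd _) (orec_fst _))) => w.
      by rewrite nfst_npair nsnd_npair.
    rewrite /orec2; apply: orec_negb; apply: orec_andb => //; apply: orec_negb.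
    exact: orec_app1 Clg (orec_fst _).
  - by move=> x; rewrite /top; case: ex_minnP => m ->.
  - move=> x i; rewrite /top; case: ex_minnP => m _ min; apply: contraL.
    by rewrite eqb0 negbK => /min; rewrite leqNgt.
(* The top supplies the node and the label of [x] the index, which together determine [f x]; the
   private label of padding already contains [f x]. *)
have C : orec halting_oracle (fun x => if nfst (lab (f x)) == 0 then
    npair (nsnd (lab (f (top x)))) (lsize (nsnd (lab (f x)))) else nsnd (lab (f x))).
  have C4 := orec_app1 C1 Ctop; cbv beta in C4.
  apply: orec_if; [apply: orec_eq; [exact: orec_app1 (orec_fst _) C1 | exact: orec_const] | |].
    apply: orec_pair; first exact: orec_app1 (orec_snd _) C4.
    exact: orec_app1 (orec_lsize _) (orec_app1 (orec_snd _) C1).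
  exact: orec_app1 (orec_snd _) C1.
apply: orec_ext C => x; case l: (legit rho (f x)); last first.
  by rewrite /lab l nfst_npair nsnd_npair.
have [s [i [E Ts is_]]] := legit_elt l.
rewrite E lab_elt // nfst_npair nsnd_npair /= lsize_lc size_takel //.
rewrite /top; case: ex_minnP => z /andP[/eqP ez /negP nz] _; move: ez.
rewrite E cls_elt // {1}/cls; case: ifP => [|_ /npair_inj[] //].
case/legit_elt=> t [j [Ez Tt jt]]; rewrite Ez nfst_npair => /npair_inj[_ /lc_inj st].
rewrite -st in Ez Tt jt *.
(* As [z] is not [longer], its index reaches [size s] and its label is all of [s]. *)
have js : size s <= j by rewrite leqNgt; apply/negP => lt; apply/nz/Hlg/(longer_elt Ez).
by rewrite lab_elt // nsnd_npair take_oversize.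
Qed.

(** Since [f] is injective with right inverse [g], the only preimage of [y] is [g y], and a search
    finds it. *)
Lemma wf_orec_inverse : orec halting_oracle g.
Proof.
have Cf := wf_orec_embedding.
apply: (@orec_mu _ (fun x y => f x != y)).
- by rewrite /orec2; orec_tac.
- by move=> y; rewrite wf_embeddingK eqxx.
- move=> y x xy; rewrite eqb0 negbK; apply/negP => /eqP e.
  by move: xy; rewrite -e -{1}(f_inj (wf_embeddingK (f x))) ltnn.
Qed.

End WellFounded.

(** * Pi^1_1-hardness *)

Lemma init_code_lmap h g m : init_code (fun i => h (g i)) m = lmap h (init_code g m).
Proof. by rewrite lmapE -map_comp. Qed.

Lemma orec_lmap A h l : orec A h -> orec A l -> orec A (fun x => lmap h (l x)).
Proof. by move=> Ch Cl; rewrite /lmap; orec_list_tac. Qed.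

Lemma eval_world_nf : exists2 rho, orec0 rho &
  forall g, eval_world g <-> forall m, rho (init_code g m) != 0.
Proof.
have C : frec (fun g z => eval_world_at g (nfst (nsnd z)) (nfst (nsnd (nsnd z)))
  (nfst (nsnd (nsnd (nsnd z)))) (nsnd (nsnd (nsnd (nsnd z))))).
  by apply: frec_eval_world_at; frec_tac.
(* The condition has no parameter, so the one from [frec_nf] is set to 0. *)
have [rho Cr Hr] := frec_nf C; exists (rho 0).
  by apply: (@orec_app2 _ rho (fun=> 0) (fun x => x)); orec_tac.
move=> g; rewrite -Hr; split=> [B x|B o k c x]; first by rewrite B.
have := B (npair o (npair k (npair c x))); rewrite !(nfst_npair, nsnd_npair).
by case: eval_world_at.
Qed.

(* The second components of a path form an [eval_world]. *)
Lemma Pi11_tree Y : Pi11 Y -> exists rho : nat -> nat -> nat,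
  [/\ orec2 empty_oracle rho,
      forall n, Y n <-> ~ exists g, forall m, rho n (init_code g m) != 0 &
      forall n g, (forall m, rho n (init_code g m) != 0) -> ~ zero_jump_computable g].
Proof.
case=> r [Cr Hr]; have [rb Cb Hb] := eval_world_nf.
have {}Cr : orec0 r by apply/orec_computable.
pose rho n l := nat_of_bool ((r (atom n (lmap nfst l)) != 0) && (rb (lmap nsnd l) != 0)).
have rhoE n g : (forall m, rho n (init_code g m) != 0) <->
    (forall m, r (pickle (n, [seq nfst (g i) | i <- iota 0 m])) != 0) /\
    eval_world (fun i => nsnd (g i)).
  rewrite Hb /rho; split=> [H|[H1 H2] m].
    have {}H m : (r (atom n (lmap nfst (init_code g m))) != 0) &&
        (rb (lmap nsnd (init_code g m)) != 0).
      by have := H m; case: (_ && _).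
    split=> m; have /andP[] := H m; last by rewrite (init_code_lmap nsnd g).
    by rewrite -(init_code_lmap nfst g) atomE.
  by rewrite -(init_code_lmap nfst g) -(init_code_lmap nsnd g) atomE H1 H2.
exists rho; split.
- have Cf : orec0 (fun w => lmap nfst (nsnd w)) by apply: orec_lmap; orec_tac.
  have Cs : orec0 (fun w => lmap nsnd (nsnd w)) by apply: orec_lmap; orec_tac.
  by rewrite /orec2 /rho /atom; orec_tac.
- move=> n; rewrite Hr; split=> [H [g /rhoE[H1 _]]|H g].
    by have [m E] := H (fun i => nfst (g i)); have := H1 m; rewrite E.
  apply: NNPP => no; apply: H.
  (* Membership in [Y] concerns the first component only; any world serves as the second. *)
  have [b Bb _] := eval_world_exists (fun _ _ => 0).
  exists (fun i => npair (g i) (b i)); apply/rhoE.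
  have -> : (fun i => nsnd (npair (g i) (b i))) = b.
    by apply: functional_extensionality => i; rewrite nsnd_npair.
  split=> // m; apply/eqP => E; apply: no; exists m.
  by apply: etrans E; congr (r (pickle (n, _))); apply: eq_map => i; rewrite nfst_npair.
- move=> n g /rhoE[_ B] /orec_computable Cg; apply: (eval_world_not_0jump B).
  by apply/orec_computable; orec_tac.
Qed.

Lemma lstruct_index c n cl lb : (forall x, ev empty_oracle c (npair n x) (lstruct_char cl lb x)) ->
  is_struct_index (smn c n) /\ forall i s, struct_of (smn c n) i s <-> lstruct cl lb i s.
Proof.
move=> Ec; split=> [x|i s].
  by exists (lstruct_char cl lb x); split; [exact: lstruct_char_le1 | apply/phi_smn].
rewrite -lstruct_charP /struct_of /phi0 phi_smn; split=> [h|<- //].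
exact: ev_inj (Ec _) h.
Qed.

Lemma orec_cls_lab (rho : nat -> nat -> nat) : orec2 empty_oracle rho ->
  orec2 empty_oracle (fun n => cls (rho n)) /\ orec2 empty_oracle (fun n => lab (rho n)).
Proof.
by move=> Cr; split; rewrite /orec2 /cls /lab /legit /in_treeb; orec_list_tac.
Qed.

Lemma orec_lstruct_char A cl lb : orec2 A cl -> orec2 A lb ->
  orec2 A (fun n => lstruct_char (cl n) (lb n)).
Proof. by move=> Ccl Clb; rewrite /orec2 /lstruct_char; orec_tac. Qed.

Lemma orec2_succ A f : orec2 A f -> orec2 A (fun n x => f n x.+1).
Proof. by move=> Cf; rewrite /orec2; orec_tac. Qed.

Lemma index_set_hard Y : Pi11 Y -> m_reducible Y index_set_0jump_cbe.
Proof.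
case/Pi11_tree=> rho [Cr HY no0].
have [Ccls Clab] := orec_cls_lab Cr.
have [c Ec] : orec0 (fun w => lstruct_char (cls (rho (nfst w))) (lab (rho (nfst w))) (nsnd w)).
  exact: (orec_lstruct_char Ccls Clab).
(* [c'] computes, uniformly in [n], the structure without the root class: the element 0 is removed
   by a shift. *)
have [c' Ec'] : orec0 (fun w => lstruct_char (fun x => cls (rho (nfst w)) x.+1)
    (fun x => lab (rho (nfst w)) x.+1) (nsnd w)).
  exact: (orec_lstruct_char (orec2_succ Ccls) (orec2_succ Clab)).
exists (smn c); split; first by apply/orec_computable/orec_smn.
move=> n.
have [ie sE] : is_struct_index (smn c n) /\
  forall i s, struct_of (smn c n) i s <-> lstruct (cls (rho n)) (lab (rho n)) i s.
  by apply: lstruct_index => x; have := Ec (npair n x); rewrite nfst_npair nsnd_npair.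
have [ia aE] : is_struct_index (smn c' n) /\
  forall i s, struct_of (smn c' n) i s <->
    lstruct (fun x => cls (rho n) x.+1) (fun x => lab (rho n) x.+1) i s.
  by apply: lstruct_index => x; have := Ec' (npair n x); rewrite nfst_npair nsnd_npair.
have toS f A := proj1 (structure_ext sE f A); have ofS f A := proj2 (structure_ext sE f A).
rewrite HY; split=> [nopath|[_ cat] [g gP]].
  split=> // a sa [[f /ofS f_emb] [g /toS g_emb]].
  have wf h : ~ forall m, rho n (init_code h m) != 0 by move=> hP; apply: nopath; exists h.
  exists f, g; split; first exact/orec_computable/(wf_orec_embedding wf sa f_emb g_emb).
  split; first exact/orec_computable/(wf_orec_inverse wf sa f_emb g_emb).
  by split; [apply/ofS | apply/toS].
have toA f A := proj1 (structure_ext aE f A); have ofA f A := proj2 (structure_ext aE f A).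
have [|f [k [_ [Ck [_ /toS/ofA k_emb]]]]] := cat _ ia.
  split; first by exists S; apply/toA/ofS/succ_embedding.
  by exists (fun x => (path_shift (rho n) g x).-1); apply/toS/ofA/path_shift_embedding_succ.
(* Followed by the successor, [k] becomes a self-embedding that never takes the value 0, so it moves
   the root. *)
have h_emb := embedding_comp k_emb (succ_embedding (rho n)).
have T0 : in_tree (rho n) [::] by move=> [|m] // _; apply: (gP 0).
have H0 : node_map (fun x => (k x).+1) [::] <> [::].
  have [e _ _ _] := self_embedding_elt h_emb T0 (leq0n _).
  by move=> E; move: e; rewrite E.
(* The resulting path is computable from [k], hence from 0', against the choice of the tree. *)
apply: no0 (iter_pathP h_emb T0 H0) _; apply/orec_computable.
have {}Ck : orec halting_oracle k by apply/orec_computable.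
by rewrite /iter_path; orec_tac.
Qed.

Theorem theorem4p2 : Pi11_complete index_set_0jump_cbe.
Proof. by split; [exact: index_set_Pi11 | exact: index_set_hard]. Qed.
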